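(* Let $f$ be a non-constant entire function that partially shares three (pairwise distinct) finite values $a_1,a_2,a_3 \in \mathbb{C}$ with its derivative $f'$. Then $f \equiv f'$.
   Context: $\widehat{\mathbb{C}} = \mathbb{C}\cup\{\infty\}$ is the Riemann sphere; meromorphic means meromorphic in the whole complex plane. A non-constant meromorphic function $f \colon \mathbb{C} \to \widehat{\mathbb{C}}$ shares the value $a \in \widehat{\mathbb{C}}$ partially with a non-constant meromorphic function $g \colon \mathbb{C} \to \widehat{\mathbb{C}}$ if for all $z_0 \in \mathbb{C}$ we have the implication $f(z_0)=a \Rightarrow g(z_0)=a$. (In particular, a value that $f$ omits in $\mathbb{C}$ is partially shared by $f$ with $g$.) Here this is applied with $g = f'$. *)

(* Defs.v *)
From Coquelicot Require Import Coquelicot.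

(* [is_derive] and [ex_derive] apply to any normed module over any absolute
   ring; at [C_AbsRing] they mean complex differentiability.  The instance is
   the one used by [C_derive_correct] and [is_C_derive_unique], so [C_derive f]
   is the derivative of an entire [f]. *)
Definition entire (f : C -> C) : Prop :=
  forall z : C, @ex_derive C_AbsRing C_NormedModule f z.

Definition nonconstant (f : C -> C) : Prop :=
  ~ exists c : C, forall z : C, f z = c.

(* One-sided: [g] may take the value [a] where [f] does not, and a value
   omitted by [f] is partially shared by [f] with every [g]. *)
Definition partially_shares (f g : C -> C) (a : C) : Prop :=
  forall z : C, f z = a -> g z = a.

(* Main.v *)
From Stdlib Require Import Reals Lra Psatz ssreflect ClassicalEpsilon.
Require Import Defs.
From Coquelicot Require Import Coquelicot.

(** Suppose that f is entire and shares a1, a2, a3 partially with f', and put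
    P(w) = (w - a1)(w - a2)(w - a3).  The function phi = f' (f - f') / P(f) is
    bounded near every a_j-point z of f: sharing gives f'(z) = a_j = f(z), so
    f - f' vanishes at z, and f' / (f - a_j) has only a simple pole there
    ([shared_point_bound]).  The proof shows that phi vanishes, by a maximum
    principle in the manner of Ahlfors' extension of the Schwarz lemma.

    Let x_j = |w - a_j|^(1/8) and H = prod_j x_j (1 + x_j).  The function
    S = |phi| H(f), called [density] below, is continuous on the whole plane
    and vanishes at the a_j-points ([density_cont]).  Where S > 0, the functions
    ln |f'|, ln |f - f'| and v_j = ln |f - a_j| are harmonic, and ln S is their
    linear combination plus the sum over j of ln (1 + exp (v_j / 8)), a convex
    function of v_j.  Hence the Laplacian of ln S is X = |f'|^2 L(f) for an
    explicit L > 0 ([density_laplacian]).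

    The point of the exponent 1/8 is that G = H / |P| satisfies G <= K L and
    (|w| G)^2 <= K L for some constant K ([weights_bound_values]).  Close to a_j
    the factor x_j beats the simple pole.  Near infinity G, |w|^2 G^2 and L are
    of order |w|^(-9/4), |w|^(-5/2) and |w|^(-17/8); here it matters that there
    are three values, since for two values G would only be of order |w|^(-3/2).
    From S <= |f'| (|f| + |f'|) G(f) one gets S <= y + y^2 with y^2 = K X.

    Such a strongly subharmonic ln S forces S to be small at the centre of a
    large disc ([ahlfors_vanishing]).  With D(z) = r^2 - |z - p|^2, the Laplacian of
    ln S + 3 ln D is at most 0 at a point where S D^3 is maximal on the disc of
    radius r about p.  This reads X <= 12 r^2 / D^2 and bounds S(p) by a constant
    times 1/r.  As r is arbitrary, S = 0, that is, f' (f - f') = 0 everywhere.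
    If f(z) <> f'(z) at one point, then f' vanishes near z, so it vanishes
    identically and f is constant.

    The argument uses that f' and f'' are again entire ([entire_deriv]) and that
    an entire function other than 0 factors as (z - p)^m g(z) with g(p) <> 0
    ([entire_factor]).  Both are derived from Cauchy's integral formula on
    circles ([cauchy_formula]), which in turn rests on Goursat's theorem for
    triangles ([goursat_triangle]). *)

Local Open Scope C_scope.

(** * Complex derivatives and continuity *)

Definition cderiv (f : C -> C) (z l : C) : Prop :=
  @is_derive C_AbsRing C_NormedModule f z l.

Lemma cderiv_eps (f : C -> C) (z l : C) :
  cderiv f z l <->
  (forall eps : R, (0 < eps)%R -> exists d : R, (0 < d)%R /\
     forall w : C, (Cmod (w - z) < d)%R ->
       (Cmod (f w - f z - (w - z) * l) <= eps * Cmod (w - z))%R).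
Proof.
  split.
  - intros [_ H] eps He.
    destruct (H z (fun P HP => HP) (mkposreal eps He)) as [d Hd].
    exists d; split; [apply cond_pos|]. exact Hd.
  - intros H; split.
    + apply is_linear_scal_l.
    + intros x Hx.
      pose proof (is_filter_lim_locally_unique _ _ Hx) as <-.
      intros eps. destruct (H eps (cond_pos eps)) as [d [Hd Hb]].
      exists (mkposreal d Hd). exact Hb.
Qed.

Lemma cderiv_const (c z : C) : cderiv (fun _ => c) z 0.
Proof. apply (@is_derive_const C_AbsRing C_NormedModule). Qed.

Lemma cderiv_id (z : C) : cderiv (fun w => w) z 1.
Proof.
  apply cderiv_eps; intros eps He; exists 1%R; split; [lra|]; intros w _.
  replace (w - z - (w - z) * 1) with (0 : C) by ring.
  rewrite Cmod_0. apply Rmult_le_pos; [lra|apply Cmod_ge_0].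
Qed.

Lemma cderiv_plus (f g : C -> C) (z lf lg : C) :
  cderiv f z lf -> cderiv g z lg -> cderiv (fun w => f w + g w) z (lf + lg).
Proof. apply (@is_derive_plus C_AbsRing C_NormedModule). Qed.

Lemma cderiv_minus (f g : C -> C) (z lf lg : C) :
  cderiv f z lf -> cderiv g z lg -> cderiv (fun w => f w - g w) z (lf - lg).
Proof. apply (@is_derive_minus C_AbsRing C_NormedModule). Qed.

Lemma cderiv_eq (f : C -> C) (z l l' : C) : cderiv f z l -> l = l' -> cderiv f z l'.
Proof. now intros H <-. Qed.

Lemma cderiv_ext_loc (f g : C -> C) (z l : C) (r : R) : (0 < r)%R ->
  (forall w, (Cmod (w - z) < r)%R -> f w = g w) -> cderiv f z l -> cderiv g z l.
Proof.
  intros Hr E H. apply cderiv_eps; intros eps He.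
  destruct (proj1 (cderiv_eps f z l) H eps He) as [d' [Hd Hb]].
  exists (Rmin d' r); split; [now apply Rmin_pos|]; intros w Hw.
  rewrite -!E.
  - apply Hb. eapply Rlt_le_trans; [exact Hw|apply Rmin_l].
  - replace (z - z) with (0:C) by ring. now rewrite Cmod_0.
  - eapply Rlt_le_trans; [exact Hw|apply Rmin_r].
Qed.

Lemma cderiv_mult (f g : C -> C) (z lf lg : C) :
  cderiv f z lf -> cderiv g z lg -> cderiv (fun w => f w * g w) z (lf * g z + f z * lg).
Proof.
  intros [_ Hf] [_ Hg].
  assert (Hf' : @is_derive C_AbsRing (AbsRing_NormedModule C_AbsRing) f z lf)
    by (split; [apply is_linear_scal_l|exact Hf]).
  assert (Hg' : @is_derive C_AbsRing (AbsRing_NormedModule C_AbsRing) g z lg)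
    by (split; [apply is_linear_scal_l|exact Hg]).
  split; [apply is_linear_scal_l|].
  exact (proj2 (@is_derive_mult C_AbsRing f g z lf lg Hf' Hg' Cmult_comm)).
Qed.

(** Continuity refers to the product topology of R x R, as integration of
    curves does, whereas [cderiv] refers to the balls of [Cmod]; [ccont_eps] and
    [locally_C] translate between the two. *)
Definition ccont {T : UniformSpace} (f : T -> C) (x : T) : Prop :=
  @continuous T C_UniformSpace f x.

Lemma ccont_eps {T : UniformSpace} (f : T -> C) (x : T) :
  ccont f x <-> forall eps : R, (0 < eps)%R -> locally x (fun y => (Cmod (f y - f x) < eps)%R).
Proof.
  split.
  - intros H eps He. apply (H (fun w => (Cmod (w - f x) < eps)%R)).
    assert (Hp : (0 < eps / sqrt 2)%R) by (apply Rdiv_lt_0_compat; [lra|apply Rlt_sqrt2_0]).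
    exists (mkposreal _ Hp); intros w Hw.
    apply (C_NormedModule_mixin_compat2 (f x) w (mkposreal _ Hp)) in Hw.
    eapply Rlt_le_trans; [exact Hw|]. simpl. right. field.
    apply Rgt_not_eq, Rlt_sqrt2_0.
  - intros H P [eps HP]. unfold filtermap.
    generalize (H eps (cond_pos eps)). apply filter_imp.
    intros y Hy. apply HP. now apply C_NormedModule_mixin_compat1.
Qed.

Lemma locally_C (z : C) (P : C -> Prop) :
  @locally C_UniformSpace z P <-> exists d : R, (0 < d)%R /\ forall w, (Cmod (w - z) < d)%R -> P w.
Proof.
  split.
  - intros [d Hd]. exists d; split; [apply cond_pos|]; intros w Hw. apply Hd.
    now apply C_NormedModule_mixin_compat1.
  - intros [d [Hd H]].
    assert (Hp : (0 < d / sqrt 2)%R) by (apply Rdiv_lt_0_compat; [lra|apply Rlt_sqrt2_0]).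
    exists (mkposreal _ Hp); intros w Hw. apply H.
    apply (C_NormedModule_mixin_compat2 z w (mkposreal _ Hp)) in Hw.
    eapply Rlt_le_trans; [exact Hw|]. simpl. right. field.
    apply Rgt_not_eq, Rlt_sqrt2_0.
Qed.

Lemma locally_C_ball (z : C) (P : C -> Prop) (d : R) : (0 < d)%R ->
  (forall w, (Cmod (w - z) < d)%R -> P w) -> @locally C_UniformSpace z P.
Proof. intros Hd H. apply locally_C. now exists d. Qed.

Lemma ccont_delta (f : C -> C) (z : C) (eps : R) : @ccont C_UniformSpace f z -> (0 < eps)%R ->
  exists d : R, (0 < d)%R /\ forall w, (Cmod (w - z) < d)%R -> (Cmod (f w - f z) < eps)%R.
Proof. intros Hf He. apply locally_C. exact (proj1 (ccont_eps f z) Hf eps He). Qed.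

Lemma cderiv_cont (f : C -> C) (z l : C) : cderiv f z l -> @ccont C_UniformSpace f z.
Proof.
  intros H. apply ccont_eps; intros eps He.
  destruct (proj1 (cderiv_eps f z l) H 1%R Rlt_0_1) as [d [Hd Hb]].
  apply locally_C.
  assert (HM : (0 < 1 + Cmod l)%R) by (generalize (Cmod_ge_0 l); lra).
  exists (Rmin d (eps / (1 + Cmod l))); split.
  - apply Rmin_pos; [lra|]. now apply Rdiv_lt_0_compat.
  - intros w Hw.
    replace (f w - f z) with ((f w - f z - (w - z) * l) + (w-z) * l) by ring.
    eapply Rle_lt_trans; [apply Cmod_triangle|]. rewrite Cmod_mult.
    specialize (Hb w (Rlt_le_trans _ _ _ Hw (Rmin_l _ _))).
    assert (H2 := Rlt_le_trans _ _ _ Hw (Rmin_r _ _)).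
    apply (Rmult_lt_compat_r (1 + Cmod l)) in H2; [|exact HM].
    replace (eps / (1 + Cmod l) * (1 + Cmod l))%R with eps in H2 by (field; lra).
    lra.
Qed.

Lemma ccont_const {T : UniformSpace} (c : C) (x : T) : ccont (fun _ => c) x.
Proof. apply continuous_const. Qed.

Lemma ccont_plus {T : UniformSpace} (f g : T -> C) (x : T) : ccont f x -> ccont g x -> ccont (fun t => f t + g t) x.
Proof. apply (@continuous_plus T R_AbsRing C_R_NormedModule). Qed.

Lemma ccont_minus {T : UniformSpace} (f g : T -> C) (x : T) : ccont f x -> ccont g x -> ccont (fun t => f t - g t) x.
Proof. apply (@continuous_minus T R_AbsRing C_R_NormedModule). Qed.

Lemma ccont_mult {T : UniformSpace} (f g : T -> C) (x : T) : ccont f x -> ccont g x -> ccont (fun t => f t * g t) x.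
Proof.
  intros Hf Hg. apply ccont_eps; intros eps He.
  set (M := (Cmod (f x) + Cmod (g x) + 1)%R).
  assert (HM : (0 < M)%R)
    by (unfold M; generalize (Cmod_ge_0 (f x)) (Cmod_ge_0 (g x)); lra).
  set (e := Rmin 1 (eps / (2 * M))).
  assert (He' : (0 < e)%R) by (apply Rmin_pos; [lra|]; apply Rdiv_lt_0_compat; lra).
  generalize (filter_and _ _ (proj1 (ccont_eps f x) Hf e He') (proj1 (ccont_eps g x) Hg e He')).
  apply filter_imp; intros y [H1 H2].
  replace (f y * g y - f x * g x) with
    ((f y - f x) * (g y - g x) + ((f y - f x) * g x + f x * (g y - g x))) by ring.
  eapply Rle_lt_trans; [apply Cmod_triangle|].
  eapply Rle_lt_trans; [apply Rplus_le_compat_l, Cmod_triangle|].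
  rewrite !Cmod_mult.
  assert (e <= 1)%R by apply Rmin_l.
  assert (He2 : (e <= eps / (2 * M))%R) by apply Rmin_r.
  apply (Rmult_le_compat_r (2 * M)) in He2; [|lra].
  replace (eps / (2 * M) * (2 * M))%R with eps in He2 by (field; lra).
  unfold M in *.
  generalize (Cmod_ge_0 (f x)) (Cmod_ge_0 (g x)) (Cmod_ge_0 (f y - f x)) (Cmod_ge_0 (g y - g x)).
  intros. nra.
Qed.

Lemma ccont_Cmod {T : UniformSpace} (f : T -> C) (x : T) : ccont f x -> @continuous T R_UniformSpace (fun t => Cmod (f t)) x.
Proof.
  intros Hf. apply (filterlim_locally (U := R_UniformSpace)); intros eps.
  generalize (proj1 (ccont_eps f x) Hf eps (cond_pos eps)).
  apply filter_imp; intros y Hy.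
  change (Rabs (Cmod (f y) - Cmod (f x)) < eps)%R.
  assert (H1 := Cmod_triangle (f y - f x) (f x)).
  replace (f y - f x + f x) with (f y) in H1 by ring.
  assert (H2 := Cmod_triangle (- (f y - f x)) (f y)).
  replace (- (f y - f x) + f y) with (f x) in H2 by ring.
  rewrite Cmod_opp in H2.
  apply Rabs_def1; lra.
Qed.

Lemma ccont_inv {T : UniformSpace} (f : T -> C) (x : T) : f x <> 0 -> ccont f x -> ccont (fun t => / f t) x.
Proof.
  intros Hn Hf. apply ccont_eps; intros eps He.
  assert (Hm := proj1 (Cmod_gt_0 _) Hn). set (m := Cmod (f x)) in *.
  set (e := Rmin (m / 2) (eps * (m * m) / 4)).
  assert (He' : (0 < e)%R).
  { apply Rmin_pos; [lra|]. repeat apply Rmult_lt_0_compat; lra. }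
  generalize (proj1 (ccont_eps f x) Hf e He').
  apply filter_imp; intros y Hy.
  assert (H1 := Cmod_triangle (- (f y - f x)) (f y)).
  replace (- (f y - f x) + f y) with (f x) in H1 by ring.
  rewrite Cmod_opp in H1. fold m in H1.
  assert (E1 : (e <= m / 2)%R) by apply Rmin_l.
  assert (E2 : (e <= eps * (m * m) / 4)%R) by apply Rmin_r.
  assert (Hy2 : (m / 2 <= Cmod (f y))%R) by lra.
  assert (Hny : f y <> 0) by (apply Cmod_gt_0; lra).
  replace (/ f y - / f x) with (- (f y - f x) / (f y * f x)) by (field; auto).
  rewrite Cmod_div; [|now apply Cmult_neq_0]. rewrite Cmod_opp Cmod_mult. fold m.
  apply (Rmult_lt_reg_r (Cmod (f y) * m)); [nra|].
  unfold Rdiv. rewrite Rmult_assoc Rinv_l; [|nra]. nra.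
Qed.

Lemma ccont_comp {T : UniformSpace} (f : C -> C) (g : T -> C) (x : T) :
  @ccont C_UniformSpace f (g x) -> ccont g x -> ccont (fun t => f (g t)) x.
Proof. intros Hf Hg. apply (@continuous_comp T C_UniformSpace C_UniformSpace g f x Hg Hf). Qed.

Lemma cderiv_comp (f g : C -> C) (z lf lg : C) :
  cderiv f (g z) lf -> cderiv g z lg -> cderiv (fun w => f (g w)) z (lg * lf).
Proof.
  intros Hf [_ Hg].
  assert (Hg' : @is_derive C_AbsRing (AbsRing_NormedModule C_AbsRing) g z lg)
    by (split; [apply is_linear_scal_l|exact Hg]).
  exact (@is_derive_comp C_AbsRing C_NormedModule f g z lf lg Hf Hg').
Qed.

Lemma ccont_id (z : C) : @ccont C_UniformSpace (fun w => w) z.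
Proof. apply (@continuous_id C_UniformSpace). Qed.

Lemma cderiv_Cinv (z : C) : z <> 0 -> cderiv (fun w => / w) z (- / (z * z)).
Proof.
  intros Hz. apply cderiv_eps; intros eps He.
  destruct (ccont_delta _ z (eps * Cmod z) (ccont_inv _ z Hz (ccont_id z))
     (Rmult_lt_0_compat _ _ He (proj1 (Cmod_gt_0 _) Hz))) as [d1 [Hd1 H1]].
  exists (Rmin d1 (Cmod z)); split; [apply Rmin_pos; [lra|now apply Cmod_gt_0]|].
  intros w Hw.
  assert (Hw0 : w <> 0).
  { intros ->. assert (H := Rlt_le_trans _ _ _ Hw (Rmin_r _ _)).
    replace (0 - z) with (- z) in H by ring. rewrite Cmod_opp in H. lra. }
  specialize (H1 w (Rlt_le_trans _ _ _ Hw (Rmin_l _ _))).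
  replace (/ w - / z - (w - z) * - / (z * z)) with ((w - z) * (- ((/ w - / z) / z)))
    by (field; auto).
  rewrite Cmod_mult Cmod_opp Cmod_div // Rmult_comm.
  apply Rmult_le_compat_r; [apply Cmod_ge_0|].
  apply (Rmult_le_reg_r (Cmod z)); [now apply Cmod_gt_0|].
  unfold Rdiv. rewrite Rmult_assoc Rinv_l; [lra|]. apply Rgt_not_eq. now apply Cmod_gt_0.
Qed.

Lemma cderiv_inv (g : C -> C) (z l : C) :
  g z <> 0 -> cderiv g z l -> cderiv (fun w => / g w) z (- l / (g z * g z)).
Proof.
  intros Hn Hg. eapply cderiv_eq.
  - apply (cderiv_comp (fun w => / w)); [now apply cderiv_Cinv|exact Hg].
  - field; auto.
Qed.

Lemma cderiv_div (f g : C -> C) (z lf lg : C) : g z <> 0 ->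
  cderiv f z lf -> cderiv g z lg ->
  cderiv (fun w => f w / g w) z ((lf * g z - f z * lg) / (g z * g z)).
Proof.
  intros Hn Hf Hg. eapply cderiv_eq.
  - apply cderiv_mult; [exact Hf|]. apply cderiv_inv; [exact Hn|exact Hg].
  - cbv beta; field; auto.
Qed.

Lemma cderiv_unique (f : C -> C) (z l l' : C) : cderiv f z l -> cderiv f z l' -> l = l'.
Proof. intros H H'. now rewrite -(is_C_derive_unique f z l H) -(is_C_derive_unique f z l' H'). Qed.

(** * Curves and their integrals *)

Lemma scal_C_R (x : R) (c : C_R_NormedModule) : scal x c = (x : C) * c.
Proof. destruct c as [a b]. unfold scal; simpl. unfold prod_scal, scal; simpl. unfold mult; simpl.
  unfold Cmult, RtoC; simpl. f_equal; ring. Qed.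

Lemma norm_C_R (c : C_R_NormedModule) : norm c = Cmod c.
Proof. symmetry. apply Cmod_norm. Qed.

Lemma is_linear_Cmult_r (l : C) :
  @is_linear R_AbsRing C_R_NormedModule C_R_NormedModule (fun y : C => y * l).
Proof.
  split.
  - intros x y. change ((x + y) * l = x * l + y * l). ring.
  - intros k x. rewrite !scal_C_R. change (RtoC k * x * l = RtoC k * (x * l)). ring.
  - exists (Cmod l + 1)%R. split; [generalize (Cmod_ge_0 l); lra|]. intros x.
    rewrite !norm_C_R Cmod_mult. generalize (Cmod_ge_0 l) (Cmod_ge_0 x). nra.
Qed.

(** A complex derivative is in particular a real-linear one.  This makes the
    chain rule along curves and the passage to real and imaginary parts available. *)
Lemma cderiv_filterdiff (f : C -> C) (z l : C) : cderiv f z l ->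
  @filterdiff R_AbsRing C_R_NormedModule C_R_NormedModule f (locally z) (fun y : C => y * l).
Proof.
  intros H. split; [apply is_linear_Cmult_r|].
  intros x Hx. pose proof (is_filter_lim_locally_unique _ _ Hx) as <-.
  intros eps. destruct (proj1 (cderiv_eps f z l) H eps (cond_pos eps)) as [d [Hd Hb]].
  apply (locally_C_ball z _ d Hd). intros w Hw.
  rewrite !norm_C_R. exact (Hb w Hw).
Qed.

Definition curve_deriv (g : R -> C) (t : R) (l : C) : Prop :=
  @is_derive R_AbsRing C_R_NormedModule g t l.

Lemma cderiv_curve (f : C -> C) (g : R -> C) (t : R) (l d : C) :
  cderiv f (g t) l -> curve_deriv g t d -> curve_deriv (fun s => f (g s)) t (d * l).
Proof.
  intros Hf Hg. unfold curve_deriv, is_derive.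
  eapply filterdiff_ext_lin.
  - apply (@filterdiff_comp' R_AbsRing _ C_R_NormedModule C_R_NormedModule g f t _ _ Hg (cderiv_filterdiff _ _ _ Hf)).
  - intros y. rewrite !scal_C_R. change (RtoC y * d * l = RtoC y * (d * l)). ring.
Qed.

Lemma curve_deriv_Re (g : R -> C) (t : R) (d : C) :
  curve_deriv g t d -> is_derive (fun s => Re (g s)) t (Re d).
Proof.
  intros Hg. unfold is_derive. eapply filterdiff_ext_lin.
  - apply (@filterdiff_comp' R_AbsRing _ C_R_NormedModule R_NormedModule g Re t _ Re Hg).
    apply filterdiff_linear, is_linear_fst.
  - intros y. simpl. reflexivity.
Qed.

Lemma curve_deriv_Im (g : R -> C) (t : R) (d : C) :
  curve_deriv g t d -> is_derive (fun s => Im (g s)) t (Im d).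
Proof.
  intros Hg. unfold is_derive. eapply filterdiff_ext_lin.
  - apply (@filterdiff_comp' R_AbsRing _ C_R_NormedModule R_NormedModule g Im t _ Im Hg).
    apply filterdiff_linear, is_linear_snd.
  - intros y. simpl. reflexivity.
Qed.

Lemma curve_deriv_pair (g : R -> C) (t x y : R) :
  is_derive (fun s => Re (g s)) t x -> is_derive (fun s => Im (g s)) t y ->
  curve_deriv g t (x, y).
Proof.
  intros H1 H2. unfold curve_deriv, is_derive.
  apply (filterdiff_ext (fun s => (Re (g s), Im (g s)))).
  - intros s. now destruct (g s).
  - eapply filterdiff_ext_lin.
    + apply (@filterdiff_comp'_2 R_AbsRing _ R_NormedModule R_NormedModule C_R_NormedModule
        (fun s => Re (g s)) (fun s => Im (g s)) pair t _ _ pair H1 H2).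
      apply filterdiff_linear. split; try reflexivity.
      exists 1%R; split; [lra|]. intros [u v]. rewrite Rmult_1_l. apply Rle_refl.
    + intros s. reflexivity.
Qed.

Definition Cint (g : R -> C) (a b : R) : C := @RInt C_R_CompleteNormedModule g a b.
Definition Rcont (g : R -> C) : Prop := forall t : R, @ccont R_UniformSpace g t.

Lemma Cint_correct (g : R -> C) (a b : R) : Rcont g ->
  @is_RInt C_R_NormedModule g a b (Cint g a b).
Proof.
  intros Hg. apply (@RInt_correct C_R_CompleteNormedModule).
  apply (@ex_RInt_continuous C_R_CompleteNormedModule). intros t _. apply Hg.
Qed.

Lemma Cint_unique (g : R -> C) (a b : R) (l : C) :
  @is_RInt C_R_NormedModule g a b l -> Cint g a b = l.
Proof. apply (@is_RInt_unique C_R_CompleteNormedModule). Qed.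

Lemma Cint_ext (f g : R -> C) (a b : R) : (forall t, f t = g t) -> Cint f a b = Cint g a b.
Proof. intros E. apply (@RInt_ext C_R_CompleteNormedModule). intros; apply E. Qed.

Lemma Cint_minus (f g : R -> C) (a b : R) : Rcont f -> Rcont g ->
  Cint (fun t => f t - g t) a b = Cint f a b - Cint g a b.
Proof.
  intros Hf Hg. apply Cint_unique.
  apply (@is_RInt_minus C_R_NormedModule); now apply Cint_correct.
Qed.

(** Multiplication by i exchanges the two real integrals up to a sign; together with
    real scaling it gives complex linearity in [Cint_mult_l]. *)
Lemma is_RInt_Ci (g : R -> C) (a b : R) (l : C) : @is_RInt C_R_NormedModule g a b l ->
  @is_RInt C_R_NormedModule (fun t => Ci * g t) a b (Ci * l).
Proof.
  intros H.
  assert (H1 := @is_RInt_fct_extend_fst R_NormedModule R_NormedModule g a b l H).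
  assert (H2 := @is_RInt_fct_extend_snd R_NormedModule R_NormedModule g a b l H).
  replace (Ci * l) with ((- Im l)%R, Re l) by
    (destruct l; unfold Ci, Cmult; simpl; f_equal; ring).
  apply (@is_RInt_fct_extend_pair R_NormedModule R_NormedModule).
  - apply (@is_RInt_ext R_NormedModule (fun t => opp (snd (g t)))).
    + intros t _. unfold opp; simpl. ring.
    + apply: is_RInt_opp. exact H2.
  - apply (@is_RInt_ext R_NormedModule (fun t => fst (g t))).
    + intros t _. simpl. ring.
    + exact H1.
Qed.

Lemma Cint_mult_l (c : C) (g : R -> C) (a b : R) : Rcont g ->
  Cint (fun t => c * g t) a b = c * Cint g a b.
Proof.
  intros Hg. apply Cint_unique. assert (H := Cint_correct g a b Hg).
  assert (H1 := @is_RInt_scal C_R_NormedModule g a b (Re c) _ H).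
  assert (H2 := @is_RInt_scal C_R_NormedModule _ a b (Im c) _ (is_RInt_Ci g a b _ H)).
  assert (H3 := @is_RInt_plus C_R_NormedModule _ _ a b _ _ H1 H2).
  assert (E : forall x : C, plus (scal (Re c) (x : C_R_NormedModule)) (scal (Im c) (Ci * x : C_R_NormedModule)) = c * x).
  { intros x. rewrite !scal_C_R. change (Re c * x + Im c * (Ci * x) = c * x).
    destruct c as [c1 c2], x as [x1 x2]. unfold Ci, Cmult, Cplus, RtoC; simpl. f_equal; ring. }
  rewrite E in H3. apply: is_RInt_ext H3. intros t _. apply E.
Qed.

Lemma Cint_bound (g : R -> C) (a b M : R) : Rcont g -> (a <= b)%R ->
  (forall t, (a <= t <= b)%R -> (Cmod (g t) <= M)%R) -> (Cmod (Cint g a b) <= (b - a) * M)%R.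
Proof.
  intros Hg Hab HM. rewrite -norm_C_R.
  apply (@norm_RInt_le_const C_R_NormedModule g a b); [exact Hab| |now apply Cint_correct].
  intros t Ht. rewrite norm_C_R. now apply HM.
Qed.

Lemma Cint_deriv (g dg : R -> C) (a b : R) : (forall t, curve_deriv g t (dg t)) -> Rcont dg ->
  Cint dg a b = g b - g a.
Proof.
  intros Hd Hc. apply Cint_unique.
  apply (@is_RInt_derive C_R_CompleteNormedModule); intros t _; [apply Hd|apply Hc].
Qed.

Lemma Cint_Chasles (g : R -> C) (a b c : R) : Rcont g ->
  Cint g a b + Cint g b c = Cint g a c.
Proof.
  intros Hg. symmetry. apply Cint_unique.
  apply (@is_RInt_Chasles C_R_NormedModule g a b c); now apply Cint_correct.
Qed.

Lemma Cint_const (c : C) (a b : R) : Cint (fun _ => c) a b = (b - a)%R * c.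
Proof.
  apply Cint_unique. rewrite -scal_C_R. apply (@is_RInt_const C_R_NormedModule).
Qed.

Lemma Cint_comp_lin (g : R -> C) (u v a b : R) : Rcont g ->
  u * Cint (fun t => g (u * t + v)%R) a b = Cint g (u * a + v) (u * b + v).
Proof.
  intros Hg. symmetry. unfold Cint at 1.
  rewrite -(@RInt_comp_lin C_R_CompleteNormedModule g u v a b).
  - rewrite -Cint_mult_l.
    + apply (@RInt_ext C_R_CompleteNormedModule). intros t _. now rewrite -scal_C_R.
    + intros t. apply: (@continuous_comp R_UniformSpace R_UniformSpace C_UniformSpace); [|apply Hg].
      apply: (@continuous_plus R_UniformSpace R_AbsRing R_NormedModule); [|apply continuous_const].
      apply: (@continuous_scal_r R_UniformSpace R_AbsRing R_NormedModule). apply continuous_id.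
  - apply (@ex_RInt_continuous C_R_CompleteNormedModule). intros t _. apply Hg.
Qed.

(** * Goursat's theorem and primitives *)

Definition cont (f : C -> C) : Prop := forall z : C, @ccont C_UniformSpace f z.

Definition seg_int (f : C -> C) (a b : C) : C :=
  (b - a) * Cint (fun t => f (a + t * (b - a))) 0 1.

Lemma curve_cont (g : R -> C) (t : R) (d : C) : curve_deriv g t d -> @ccont R_UniformSpace g t.
Proof.
  intros H. apply (@ex_derive_continuous R_AbsRing C_R_NormedModule). now exists d.
Qed.

Lemma curve_line (a e : C) (t : R) : curve_deriv (fun s : R => a + s * e) t e.
Proof.
  destruct a as [a1 a2], e as [e1 e2].
  apply curve_deriv_pair; simpl; auto_derive; trivial; ring.
Qed.

Lemma Rcont_comp (f : C -> C) (g : R -> C) : cont f -> Rcont g -> Rcont (fun t => f (g t)).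
Proof. intros Hf Hg t. apply ccont_comp; [apply Hf|apply Hg]. Qed.

Lemma Rcont_line (a e : C) : Rcont (fun s : R => a + s * e).
Proof. intros t. apply (curve_cont _ _ e), curve_line. Qed.

Lemma cont_seg (f : C -> C) (a e : C) : cont f -> Rcont (fun t : R => f (a + t * e)).
Proof. intros Hf. apply Rcont_comp; [exact Hf|apply Rcont_line]. Qed.

Lemma seg_bound (f : C -> C) (a b : C) (M : R) : cont f ->
  (forall t : R, (0 <= t <= 1)%R -> (Cmod (f (a + t * (b - a))%C) <= M)%R) ->
  (Cmod (seg_int f a b) <= Cmod (b - a) * M)%R.
Proof.
  intros Hf HM. unfold seg_int. rewrite Cmod_mult.
  apply Rmult_le_compat_l; [apply Cmod_ge_0|].
  eapply Rle_trans; [apply (Cint_bound _ 0 1 M); [now apply cont_seg|lra|exact HM]|]. lra.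
Qed.

Lemma seg_minus (f g : C -> C) (a b : C) : cont f -> cont g ->
  seg_int (fun z => f z - g z) a b = seg_int f a b - seg_int g a b.
Proof.
  intros Hf Hg. unfold seg_int. rewrite Cint_minus; [ring|now apply cont_seg|now apply cont_seg].
Qed.

Lemma seg_deriv (F f : C -> C) (a b : C) : (forall z, cderiv F z (f z)) -> cont f ->
  seg_int f a b = F b - F a.
Proof.
  intros HF Hf. unfold seg_int. rewrite -Cint_mult_l; [|now apply cont_seg].
  rewrite (Cint_deriv (fun t => F (a + t * (b - a)))).
  - cbv beta. replace (a + 1 * (b - a)) with b by ring. replace (a + 0 * (b - a)) with a by ring.
    reflexivity.
  - intros t. apply cderiv_curve; [apply HF|apply curve_line].
  - intros t. apply ccont_mult; [apply ccont_const|now apply cont_seg].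
Qed.

Lemma RtoC_m1 : RtoC (-1) = - RtoC 1.
Proof. rewrite -RtoC_opp. f_equal. Qed.

Lemma seg_rev (f : C -> C) (a b : C) : cont f -> seg_int f b a = - seg_int f a b.
Proof.
  intros Hf. unfold seg_int.
  assert (H := Cint_comp_lin (fun t => f (a + t * (b - a))) (-1) 1 0 1 (cont_seg f a (b - a) Hf)).
  replace (-1 * 0 + 1)%R with 1%R in H by ring. replace (-1 * 1 + 1)%R with 0%R in H by ring.
  assert (H2 := Cint_Chasles (fun t => f (a + t * (b - a))) 0 1 0 (cont_seg f a (b - a) Hf)).
  assert (H3 : Cint (fun t => f (a + t * (b - a))) 0 0 = 0) by
    apply (@RInt_point C_R_CompleteNormedModule).
  rewrite H3 -H in H2.
  rewrite (Cint_ext (fun t => f (b + t * (a - b))) (fun t => f (a + (-1 * t + 1)%R * (b - a)))).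
  - set (X := Cint (fun t => f (a + (-1 * t + 1)%R * (b - a))) 0 1) in *.
    set (Y := Cint (fun t => f (a + t * (b - a))) 0 1) in *.
    replace Y with X; [ring|]. 
    replace Y with ((Y + (-1)%R * X) + X) by (rewrite RtoC_m1; ring). rewrite H2. ring.
  - intros t. f_equal. rewrite RtoC_plus RtoC_mult RtoC_m1. ring.
Qed.

Lemma C2_nz : RtoC 2 <> 0.
Proof. intros E. apply RtoC_inj in E. lra. Qed.

Lemma RtoC_half : RtoC (/ 2) = / RtoC 2.
Proof. apply RtoC_inv. lra. Qed.

Lemma seg_mid (f : C -> C) (a b : C) : cont f ->
  seg_int f a b = seg_int f a ((a + b) / 2) + seg_int f ((a + b) / 2) b.
Proof.
  intros Hf. unfold seg_int.
  assert (Hc := cont_seg f a (b - a) Hf).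
  assert (H1 := Cint_comp_lin _ (/2) 0 0 1 Hc).
  assert (H2 := Cint_comp_lin _ (/2) (/2) 0 1 Hc).
  replace (/ 2 * 0 + 0)%R with 0%R in H1 by ring.
  replace (/ 2 * 1 + 0)%R with (/2)%R in H1 by ring.
  replace (/ 2 * 0 + / 2)%R with (/2)%R in H2 by ring.
  replace (/ 2 * 1 + / 2)%R with 1%R in H2 by field.
  rewrite -(Cint_Chasles _ 0 (/2) 1 Hc) -H1 -H2.
  assert (E2 := C2_nz).
  rewrite (Cint_ext (fun t => f (a + t * ((a + b) / 2 - a)))
    (fun t => f (a + (/ 2 * t + 0)%R * (b - a))));
    [|intros t; f_equal; rewrite RtoC_plus RtoC_mult RtoC_half; field; exact E2].
  rewrite (Cint_ext (fun t => f ((a + b) / 2 + t * (b - (a + b) / 2)))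
    (fun t => f (a + (/ 2 * t + / 2)%R * (b - a))));
    [|intros t; f_equal; rewrite RtoC_plus RtoC_mult RtoC_half; field; exact E2].
  rewrite RtoC_half. field; exact E2.
Qed.

Definition tri_int (f : C -> C) (a b c : C) : C := seg_int f a b + seg_int f b c + seg_int f c a.
Definition perim (a b c : C) : R := (Cmod (b - a) + Cmod (c - b) + Cmod (a - c))%R.

(** The three inner edges are traversed once in each direction. *)
Lemma tri_split (f : C -> C) (a b c : C) : cont f ->
  tri_int f a b c = tri_int f a ((a + b) / 2) ((c + a) / 2) + tri_int f ((a + b) / 2) b ((b + c) / 2)
    + tri_int f ((c + a) / 2) ((b + c) / 2) c + tri_int f ((a + b) / 2) ((b + c) / 2) ((c + a) / 2).
Proof.
  intros Hf. unfold tri_int.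
  rewrite (seg_mid f a b Hf) (seg_mid f b c Hf) (seg_mid f c a Hf).
  rewrite (seg_rev f ((c + a) / 2) ((b + c) / 2) Hf).
  rewrite (seg_rev f ((b + c) / 2) ((a + b) / 2) Hf).
  rewrite (seg_rev f ((a + b) / 2) ((c + a) / 2) Hf). ring.
Qed.

Lemma Cmod_half (x : C) : Cmod (x / 2) = (Cmod x / 2)%R.
Proof.
  rewrite Cmod_div; [|exact C2_nz]. rewrite Cmod_R Rabs_pos_eq; lra.
Qed.

Lemma Cmod_minus_sym (x y : C) : Cmod (x - y) = Cmod (y - x).
Proof. rewrite -Cmod_opp. f_equal. ring. Qed.

Lemma tri_step (f : C -> C) (t : C * C * C) : cont f ->
  exists t' : C * C * C,
    let '(a, b, c) := t in let '(a', b', c') := t' in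
    (Cmod (tri_int f a b c) <= 4 * Cmod (tri_int f a' b' c'))%R /\
    perim a' b' c' = (perim a b c / 2)%R /\ (Cmod (a' - a) <= perim a b c)%R.
Proof.
  intros Hf. destruct t as [[a b] c].
  assert (E2 := C2_nz).
  assert (Ha := Cmod_ge_0 (b - a)). assert (Hb := Cmod_ge_0 (c - b)). assert (Hc := Cmod_ge_0 (a - c)).
  set (m1 := (a + b) / 2). set (m2 := (b + c) / 2). set (m3 := (c + a) / 2).
  assert (D1 : Cmod (m1 - a) = (Cmod (b - a) / 2)%R)
    by (rewrite -Cmod_half; f_equal; unfold m1; field; exact E2).
  assert (D3 : Cmod (m3 - a) = (Cmod (a - c) / 2)%R)
    by (rewrite Cmod_minus_sym -Cmod_half; f_equal; unfold m3; field; exact E2).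
  assert (H := tri_split f a b c Hf). fold m1 m2 m3 in H.
  assert (HB : (Cmod (tri_int f a b c) <= Cmod (tri_int f a m1 m3) + Cmod (tri_int f m1 b m2)
     + Cmod (tri_int f m3 m2 c) + Cmod (tri_int f m1 m2 m3))%R).
  { rewrite H. eapply Rle_trans; [apply Cmod_triangle|]. apply Rplus_le_compat_r.
    eapply Rle_trans; [apply Cmod_triangle|]. apply Rplus_le_compat_r. apply Cmod_triangle. }
  assert (P : forall a' b' c', b' - a' = (b - a) / 2 -> c' - b' = (c - b) / 2 ->
     a' - c' = (a - c) / 2 -> perim a' b' c' = (perim a b c / 2)%R).
  { intros a' b' c' e1 e2 e3. unfold perim. rewrite e1 e2 e3 !Cmod_half. lra. }
  assert (Q : (Cmod (m1 - a) <= perim a b c /\ Cmod (m3 - a) <= perim a b c)%R)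
    by (rewrite D1 D3; unfold perim; lra).
  destruct (Rle_dec (Cmod (tri_int f a b c)) (4 * Cmod (tri_int f a m1 m3))) as [h1|h1];
    [|destruct (Rle_dec (Cmod (tri_int f a b c)) (4 * Cmod (tri_int f m1 b m2))) as [h2|h2];
    [|destruct (Rle_dec (Cmod (tri_int f a b c)) (4 * Cmod (tri_int f m3 m2 c))) as [h3|h3];
    [|destruct (Rle_dec (Cmod (tri_int f a b c)) (4 * Cmod (tri_int f m1 m2 m3))) as [h4|h4]; [|lra]]]].
  - exists (a, m1, m3). split; [exact h1|]. split.
    + apply P; unfold m1, m2, m3; field; exact E2.
    + replace (a - a) with (RtoC 0) by ring. rewrite Cmod_0. unfold perim; lra.
  - exists (m1, b, m2). split; [exact h2|]. split; [|apply Q].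
    apply P; unfold m1, m2, m3; field; exact E2.
  - exists (m3, m2, c). split; [exact h3|]. split; [|apply Q].
    apply P; unfold m1, m2, m3; field; exact E2.
  - exists (m1, m2, m3). split; [exact h4|]. split; [|apply Q].
    unfold perim.
    replace (m2 - m1) with ((c - a) / 2) by (unfold m1, m2, m3; field; exact E2).
    replace (m3 - m2) with ((a - b) / 2) by (unfold m1, m2, m3; field; exact E2).
    replace (m1 - m3) with ((b - c) / 2) by (unfold m1, m2, m3; field; exact E2).
    rewrite !Cmod_half (Cmod_minus_sym c a) (Cmod_minus_sym a b) (Cmod_minus_sym b c). lra.
Qed.

(** Telescoping: the tail of the series of steps after index n is at most
    l/2^n + l/2^(n+1) + ... = 2 l / 2^n. *)
Lemma Rseq_geom_limit (u : nat -> R) (l : R) : (0 <= l)%R ->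
  (forall n, (Rabs (u (S n) - u n) <= l / 2 ^ n)%R) ->
  exists p, forall n, (Rabs (u n - p) <= 2 * (l / 2 ^ n))%R.
Proof.
  intros Hl H.
  assert (HP : forall n, (0 < / 2 ^ n)%R) by (intros n; apply Rinv_0_lt_compat, pow_lt; lra).
  assert (K : forall n k, (Rabs (u (n + k)%nat - u n) <= 2 * (l / 2 ^ n) - 2 * (l / 2 ^ (n + k)))%R).
  { intros n; induction k as [|k IH].
    - rewrite Nat.add_0_r Rminus_diag Rabs_R0. lra.
    - rewrite Nat.add_succ_r. specialize (H (n + k)%nat).
      replace (u (S (n + k)) - u n)%R with ((u (S (n + k)) - u (n + k)%nat) + (u (n + k)%nat - u n))%R by ring.
      eapply Rle_trans; [apply Rabs_triang|].
      replace (2 * (l / 2 ^ S (n + k)))%R with (l / 2 ^ (n + k))%R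
        by (simpl; field; apply pow_nonzero; lra).
      lra. }
  assert (K' : forall n m, (n <= m)%nat -> (Rabs (u m - u n) <= 2 * (l / 2 ^ n))%R).
  { intros n m Hm. replace m with (n + (m - n))%nat by lia.
    eapply Rle_trans; [apply K|]. generalize (HP (n + (m - n))%nat). unfold Rdiv. nra. }
  destruct (proj2 (ex_lim_seq_cauchy_corr u)) as [p Hp].
  - intros eps. 
    assert (Hg := is_lim_seq_geom (/2) ltac:(rewrite Rabs_pos_eq; lra)).
    assert (Hg' : is_lim_seq (fun n => (4 * l) * (/2) ^ n)%R (4 * l * 0)%R)
      by (apply: (is_lim_seq_scal_l _ (4 * l) 0 Hg)).
    rewrite Rmult_0_r in Hg'.
    destruct (proj2 (is_lim_seq_spec _ _) Hg' eps) as [N HN]. exists N. intros n m Hn Hm.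
    specialize (HN N (le_n N)). rewrite Rminus_0_r pow_inv in HN.
    apply Rabs_def2 in HN.
    replace (u n - u m)%R with ((u n - u N) - (u m - u N))%R by ring.
    eapply Rle_lt_trans; [apply Rabs_triang|]. rewrite Rabs_Ropp.
    generalize (K' N n Hn) (K' N m Hm). unfold Rdiv. lra.
  - exists p. intros n.
    assert (Hq : is_lim_seq (fun m => Rabs (u n - u m)) (Rabs (u n - p))).
    { apply: (is_lim_seq_abs _ (u n - p)%R).
      apply: is_lim_seq_minus'; [apply is_lim_seq_const|exact Hp]. }
    assert (Hle := is_lim_seq_le_loc (fun m => Rabs (u n - u m)) (fun _ => 2 * (l / 2 ^ n))%R
      (Finite (Rabs (u n - p))) (Finite (2 * (l / 2 ^ n)))).
    apply Hle; [|exact Hq|apply is_lim_seq_const].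
    exists n. intros m Hm. rewrite Rabs_minus_sym. now apply K'.
Qed.

Lemma Cmod_le_ReIm (z : C) : (Cmod z <= Rabs (Re z) + Rabs (Im z))%R.
Proof.
  assert (z = RtoC (Re z) + Ci * RtoC (Im z)) as E.
  { destruct z; unfold Ci, Cmult, Cplus, RtoC; simpl; f_equal; ring. }
  rewrite {1}E. eapply Rle_trans; [apply Cmod_triangle|].
  rewrite Cmod_mult Cmod_Ci !Cmod_R. lra.
Qed.

Lemma im_le_Cmod (z : C) : (Rabs (Im z) <= Cmod z)%R.
Proof. eapply Rle_trans; [|apply Rmax_Cmod]. apply Rmax_r. Qed.

Lemma Cseq_geom_limit (u : nat -> C) (l : R) : (0 <= l)%R ->
  (forall n, (Cmod (u (S n) - u n) <= l / 2 ^ n)%R) ->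
  exists p, forall n, (Cmod (u n - p) <= 4 * (l / 2 ^ n))%R.
Proof.
  intros Hl H.
  destruct (Rseq_geom_limit (fun n => Re (u n)) l Hl) as [p Hp].
  { intros n. eapply Rle_trans; [|apply H]. apply (re_le_Cmod (u (S n) - u n)). }
  destruct (Rseq_geom_limit (fun n => Im (u n)) l Hl) as [q Hq].
  { intros n. eapply Rle_trans; [|apply H]. apply (im_le_Cmod (u (S n) - u n)). }
  exists (p, q). intros n. eapply Rle_trans; [apply Cmod_le_ReIm|].
  specialize (Hp n). specialize (Hq n). 
  change (Rabs (Re (u n) - p) + Rabs (Im (u n) - q) <= 4 * (l / 2 ^ n))%R. lra.
Qed.

Lemma ex_deriv_cont (f : C -> C) : (forall z, exists l, cderiv f z l) -> cont f.
Proof. intros H z. destruct (H z) as [l Hl]. now apply (cderiv_cont _ _ l). Qed.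

Lemma tri_affine (A B a b c : C) : tri_int (fun z => A + z * B) a b c = 0.
Proof.
  assert (E2 := C2_nz).
  assert (HF : forall z, cderiv (fun z => A * z + (B / 2) * (z * z)) z (A + z * B)).
  { intros z. eapply cderiv_eq.
    - apply cderiv_plus; (apply cderiv_mult; [apply cderiv_const|]); [apply cderiv_id|].
      apply cderiv_mult; apply cderiv_id.
    - cbv beta. field. }
  assert (Hc : cont (fun z => A + z * B)).
  { apply ex_deriv_cont. intros z. eexists. apply cderiv_plus; [apply cderiv_const|].
    apply cderiv_mult; [apply cderiv_id|apply cderiv_const]. }
  unfold tri_int. rewrite !(seg_deriv _ _ _ _ HF Hc). ring.
Qed.

Lemma tri_bound (f : C -> C) (a b c p : C) (e d : R) : cont f -> (0 <= e)%R ->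
  (Cmod (a - p) + perim a b c < d)%R ->
  (forall w, (Cmod (w - p) < d)%R -> (Cmod (f w) <= e * Cmod (w - p))%R) ->
  (Cmod (tri_int f a b c) <= perim a b c * (e * (Cmod (a - p) + perim a b c)))%R.
Proof.
  intros Hf He Hd Hb.
  assert (Ha := Cmod_ge_0 (b - a)). assert (Hb' := Cmod_ge_0 (c - b)). assert (Hc := Cmod_ge_0 (a - c)).
  assert (K : forall x y, (Cmod (x - a) + Cmod (y - x) <= perim a b c)%R ->
     (Cmod (seg_int f x y) <= Cmod (y - x) * (e * (Cmod (a - p) + perim a b c)))%R).
  { intros x y Hxy. apply seg_bound; [exact Hf|]. intros t Ht.
    assert (D : (Cmod (x + t * (y - x) - p) <= Cmod (a - p) + perim a b c)%R).
    { replace (x + t * (y - x) - p) with ((a - p) + ((x - a) + t * (y - x))) by ring.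
      eapply Rle_trans; [apply Cmod_triangle|]. apply Rplus_le_compat_l.
      eapply Rle_trans; [apply Cmod_triangle|].
      rewrite Cmod_mult Cmod_R Rabs_pos_eq; [|lra]. generalize (Cmod_ge_0 (y - x)). nra. }
    eapply Rle_trans; [apply Hb; lra|]. now apply Rmult_le_compat_l. }
  unfold tri_int. eapply Rle_trans; [apply Cmod_triangle|].
  assert (K1 := K a b). assert (K2 := K b c). assert (K3 := K c a).
  assert (Z : Cmod (a - a) = 0%R) by (replace (a - a) with (RtoC 0) by ring; apply Cmod_0).
  assert (S := Cmod_minus_sym a c).
  assert (T := Cmod_triangle (seg_int f a b) (seg_int f b c)).
  assert (K1' := K1 ltac:(unfold perim; lra)). assert (K2' := K2 ltac:(unfold perim; lra)).
  assert (TR := Cmod_triangle (c - b) (b - a)). replace (c - b + (b - a)) with (c - a) in TR by ring.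
  assert (K3' := K3 ltac:(unfold perim; lra)).
  set (X := (e * (Cmod (a - p) + perim a b c))%R) in *. unfold perim. lra.
Qed.

(** Bisection: among the four half-sized triangles one carries at least a quarter of
    the integral.  The nested triangles shrink to a point p, where f differs from an affine
    function by o(|w - p|).  Affine functions integrate to 0, so the n-th integral is
    o((l / 2^n)^2), where l is the initial perimeter, while it is at least 4^(-n) times the first. *)
Lemma goursat_triangle (f : C -> C) (a b c : C) :
  (forall z, exists l, cderiv f z l) -> tri_int f a b c = 0.
Proof.
  intros Hd. assert (Hf := ex_deriv_cont f Hd).
  pose (next := fun t => proj1_sig (constructive_indefinite_description _ (tri_step f t Hf))).
  assert (Hn : forall t, let '(a, b, c) := t in let '(a', b', c') := next t in
    (Cmod (tri_int f a b c) <= 4 * Cmod (tri_int f a' b' c'))%R /\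
    perim a' b' c' = (perim a b c / 2)%R /\ (Cmod (a' - a) <= perim a b c)%R).
  { intros t. exact (proj2_sig (constructive_indefinite_description _ (tri_step f t Hf))). }
  pose (sq := fix sq n := match n with O => (a, b, c) | S n => next (sq n) end).
  set (l := perim a b c).
  assert (Hl : (0 <= l)%R).
  { unfold l, perim. generalize (Cmod_ge_0 (b - a)) (Cmod_ge_0 (c - b)) (Cmod_ge_0 (a - c)). lra. }
  assert (I : forall n, let '(a', b', c') := sq n in
     (Cmod (tri_int f a b c) <= 4 ^ n * Cmod (tri_int f a' b' c'))%R /\ perim a' b' c' = (l / 2 ^ n)%R).
  { induction n as [|n IH]; simpl.
    - split; [lra|]. fold l. field.
    - specialize (Hn (sq n)). destruct (sq n) as [[a1 b1] c1].
      destruct (next (a1, b1, c1)) as [[a2 b2] c2].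
      destruct IH as [I1 I2]. destruct Hn as [N1 [N2 _]]. split.
      + generalize (pow_lt 4 n ltac:(lra)). nra.
      + rewrite N2 I2. field. apply pow_nonzero. lra. }
  destruct (Cseq_geom_limit (fun n => fst (fst (sq n))) l Hl) as [p Hp].
  { intros n. specialize (I n). simpl. specialize (Hn (sq n)). destruct (sq n) as [[a1 b1] c1].
    destruct (next (a1, b1, c1)) as [[a2 b2] c2]. simpl. destruct I as [_ <-]. apply Hn. }
  destruct (Hd p) as [f' Hf'].
  assert (Hz : forall eps, (0 < eps)%R -> (Cmod (tri_int f a b c) <= eps)%R).
  { intros eps He. set (e := (eps / (5 * (l * l) + 1))%R).
    assert (Hll : (0 <= l * l)%R) by nra.
    assert (He' : (0 < e)%R) by (apply Rdiv_lt_0_compat; lra).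
    destruct (proj1 (cderiv_eps _ _ _) Hf' e He') as [d [Hdp Hb]].
    assert (N : exists n, (5 * (l / 2 ^ n) < d)%R).
    { assert (Hg := is_lim_seq_geom (/2) ltac:(rewrite Rabs_pos_eq; lra)).
      assert (Hg' : is_lim_seq (fun n => (5 * l) * (/2) ^ n)%R (5 * l * 0)%R)
        by (apply: (is_lim_seq_scal_l _ (5 * l) 0 Hg)).
      rewrite Rmult_0_r in Hg'.
      destruct (proj2 (is_lim_seq_spec _ _) Hg' (mkposreal d Hdp)) as [N HN]. exists N.
      specialize (HN N (le_n N)). rewrite Rminus_0_r pow_inv in HN.
      apply Rabs_def2 in HN. unfold Rdiv. simpl in HN. lra. }
    destruct N as [n HN]. specialize (I n). specialize (Hp n).
    destruct (sq n) as [[a1 b1] c1]. simpl in Hp. destruct I as [I1 I2].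
    (* A + w f' is the tangent of f at p; subtracting it changes no integral over a triangle. *)
    pose (A := f p - p * f').
    assert (E : tri_int f a1 b1 c1 = tri_int (fun w => f w - (A + w * f')) a1 b1 c1).
    { assert (Hca : cont (fun w => A + w * f')).
      { apply ex_deriv_cont. intros z. eexists. apply cderiv_plus; [apply cderiv_const|].
        apply cderiv_mult; [apply cderiv_id|apply cderiv_const]. }
      transitivity (tri_int f a1 b1 c1 - tri_int (fun w => A + w * f') a1 b1 c1).
      - rewrite tri_affine. ring.
      - unfold tri_int. rewrite !seg_minus //. ring. }
    assert (Bd : (Cmod (tri_int f a1 b1 c1) <= perim a1 b1 c1 * (e * (Cmod (a1 - p) + perim a1 b1 c1)))%R).
    { rewrite E. apply (tri_bound _ _ _ _ _ _ d).
      - intros z. apply ccont_minus; [apply Hf|].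
        apply ccont_plus; [apply ccont_const|]. apply ccont_mult; [apply ccont_id|apply ccont_const].
      - lra.
      - rewrite I2. lra.
      - intros w Hw. replace (f w - (A + w * f')) with (f w - f p - (w - p) * f') by (unfold A; ring).
        now apply Hb. }
    rewrite I2 in Bd.
    assert (Hx : (0 <= l / 2 ^ n)%R).
    { apply Rmult_le_pos; [exact Hl|]. apply Rlt_le, Rinv_0_lt_compat, pow_lt; lra. }
    assert (Bd2 : (Cmod (tri_int f a1 b1 c1) <= 5 * e * ((l / 2 ^ n) * (l / 2 ^ n)))%R).
    { eapply Rle_trans; [exact Bd|].
      replace (5 * e * (l / 2 ^ n * (l / 2 ^ n)))%R with (l / 2 ^ n * (e * (5 * (l / 2 ^ n))))%R by ring.
      apply Rmult_le_compat_l; [exact Hx|]. apply Rmult_le_compat_l; lra. }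
    eapply Rle_trans; [exact I1|].
    apply Rle_trans with (4 ^ n * (5 * e * (l / 2 ^ n * (l / 2 ^ n))))%R.
    - apply Rmult_le_compat_l; [apply Rlt_le, pow_lt; lra|exact Bd2].
    - replace (4 ^ n)%R with (2 ^ n * 2 ^ n)%R by (rewrite -Rpow_mult_distr; f_equal; lra).
      replace (2 ^ n * 2 ^ n * (5 * e * (l / 2 ^ n * (l / 2 ^ n))))%R with (5 * (l * l) * e)%R
        by (field; apply pow_nonzero; lra).
      assert (Ee : ((5 * (l * l) + 1) * e = eps)%R) by (unfold e; field; lra). lra. }
  apply Cmod_eq_0. apply Rle_antisym; [|apply Cmod_ge_0].
  apply Rnot_lt_le. intros Hpos. specialize (Hz (Cmod (tri_int f a b c) / 2)%R ltac:(lra)). lra.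
Qed.

(** By Goursat's theorem for the triangle 0, z, w, the increment of the integral from 0
    is the integral over the segment from z to w. *)
Lemma primitive_exists (f : C -> C) : (forall z, exists l, cderiv f z l) ->
  exists F, forall z, cderiv F z (f z).
Proof.
  intros Hd. assert (Hf := ex_deriv_cont f Hd). exists (seg_int f 0). intros z.
  apply cderiv_eps. intros eps He.
  destruct (ccont_delta f z eps (Hf z) He) as [d [Hdp Hb]].
  exists d. split; [exact Hdp|]. intros w Hw.
  assert (H := goursat_triangle f 0 z w Hd). unfold tri_int in H. rewrite (seg_rev f 0 w Hf) in H.
  replace (seg_int f 0 w - seg_int f 0 z) with (seg_int f z w).
  2:{ revert H. generalize (seg_int f 0 z) (seg_int f z w) (seg_int f 0 w). intros x y v H.
      replace v with (x + y - (x + y + - v)) by ring. rewrite H. ring. }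
  assert (Hk : forall u, cderiv (fun x => x * f z) u (f z)).
  { intros u. eapply cderiv_eq; [apply cderiv_mult; [apply cderiv_id|apply cderiv_const]|cbv beta; ring]. }
  replace ((w - z) * f z) with (seg_int (fun _ => f z) z w).
  2:{ rewrite (seg_deriv _ _ _ _ Hk); [ring|]. intros u. apply ccont_const. }
  rewrite -seg_minus; [|exact Hf|intros u; apply ccont_const].
  rewrite Rmult_comm. apply seg_bound.
  - intros u. apply ccont_minus; [apply Hf|apply ccont_const].
  - intros t Ht. apply Rlt_le, Hb.
    replace (z + t * (w - z) - z) with (t * (w - z)) by ring.
    rewrite Cmod_mult Cmod_R Rabs_pos_eq; [|lra]. generalize (Cmod_ge_0 (w - z)). nra.
Qed.

(** * Cauchy's formula and derivatives of entire functions *)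

Definition diff_quot (F : C -> C) (l p w : C) : C :=
  match excluded_middle_informative (w = p) with
  | left _ => l
  | right _ => (F w - F p) / (w - p)
  end.

Lemma diff_quot_eq (F : C -> C) (l p : C) : diff_quot F l p p = l.
Proof. unfold diff_quot. now destruct (excluded_middle_informative (p = p)). Qed.

Lemma diff_quot_neq (F : C -> C) (l p w : C) : w <> p ->
  diff_quot F l p w = (F w - F p) / (w - p).
Proof. intros H. unfold diff_quot. now destruct (excluded_middle_informative (w = p)). Qed.

(** Integrating the first-order expansion of f at p yields a second-order expansion of
    its primitive F, so the quotient is differentiable at p too, with derivative f'(p)/2.  The
    hypothesis that F' is itself differentiable replaces the analysis of a removable singularity. *)
Lemma diff_quot_entire (F f : C -> C) (p : C) :
  (forall z, cderiv F z (f z)) -> entire f -> entire (diff_quot F (f p) p).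
Proof.
  intros HF Hf z. assert (Hc := ex_deriv_cont f Hf).
  destruct (excluded_middle_informative (z = p)) as [->|Hz].
  - destruct (Hf p) as [l Hl]. exists (l / 2). apply cderiv_eps. intros eps He.
    destruct (proj1 (cderiv_eps f p l) Hl eps He) as [d [Hd Hb]].
    exists d. split; [exact Hd|]. intros w Hw. rewrite diff_quot_eq.
    destruct (excluded_middle_informative (w = p)) as [->|Hwp].
    + rewrite diff_quot_eq. replace (f p - f p - (p - p) * (l / 2)) with (RtoC 0) by ring.
      rewrite Cmod_0. apply Rmult_le_pos; [lra|apply Cmod_ge_0].
    + rewrite diff_quot_neq //. assert (Hn := Cminus_eq_contra w p Hwp).
      (* The primitive of the linear part P is the second-order Taylor polynomial of F. *)
      set (P := fun u => f p + (u - p) * l).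
      assert (HcP : cont P).
      { intros u. apply ccont_plus; [apply ccont_const|].
        apply ccont_mult; [|apply ccont_const]. apply ccont_minus; [apply ccont_id|apply ccont_const]. }
      assert (HP : seg_int P p w = (w - p) * f p + (w - p) * (w - p) * (l / 2)).
      { rewrite (seg_deriv (fun u => (u - p) * f p + (u - p) * (u - p) * (l / 2)) P).
        - unfold P. field. 
        - intros u. eapply cderiv_eq.
          + assert (D : forall u, cderiv (fun u => u - p) u (1 - 0))
              by (intros; apply cderiv_minus; [apply cderiv_id|apply cderiv_const]).
            apply cderiv_plus; (apply cderiv_mult; [|apply cderiv_const]); [apply D|].
            apply cderiv_mult; apply D.
          + unfold P. cbv beta. field.
        - exact HcP. }
      assert (HS : (Cmod (seg_int (fun u => (f u - P u)%C) p w) <= Cmod (w - p) * (eps * Cmod (w - p)))%R).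
      { apply seg_bound.
        - intros u. apply ccont_minus; [apply Hc|apply HcP].
        - intros t Ht. unfold P.
          assert (Q : (Cmod (p + t * (w - p) - p) <= Cmod (w - p))%R).
          { replace (p + t * (w - p) - p) with (t * (w - p)) by ring.
            rewrite Cmod_mult Cmod_R Rabs_pos_eq; [|lra]. generalize (Cmod_ge_0 (w - p)). nra. }
          replace (f (p + t * (w - p)) - (f p + (p + t * (w - p) - p) * l)) with
            (f (p + t * (w - p)) - f p - (p + t * (w - p) - p) * l) by ring.
          eapply Rle_trans; [apply Hb; lra|]. apply Rmult_le_compat_l; lra. }
      rewrite (seg_minus f P p w Hc HcP) HP (seg_deriv F f p w HF Hc) in HS.
      assert (Hpos := proj1 (Cmod_gt_0 _) Hn).
      replace ((F w - F p) / (w - p) - f p - (w - p) * (l / 2)) with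
        ((F w - F p - ((w - p) * f p + (w - p) * (w - p) * (l / 2))) / (w - p))
        by (field; exact Hn).
      rewrite Cmod_div; [|exact Hn]. apply (Rmult_le_reg_r (Cmod (w - p))); [exact Hpos|].
      unfold Rdiv. rewrite Rmult_assoc Rinv_l; [|lra]. lra.
  - assert (Hn := Cminus_eq_contra z p Hz).
    assert (D : cderiv (fun w => (F w - F p) / (w - p)) z
      (((f z - 0) * (z - p) - (F z - F p) * (1 - 0)) / ((z - p) * (z - p)))).
    { apply (cderiv_div (fun w => F w - F p) (fun w => w - p)); [exact Hn| |].
      - apply cderiv_minus; [apply HF|apply cderiv_const].
      - apply cderiv_minus; [apply cderiv_id|apply cderiv_const]. }
    eexists. apply (cderiv_ext_loc (fun w => (F w - F p) / (w - p)) _ z _ (Cmod (z - p))); [|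
      |exact D].
    + now apply Cmod_gt_0.
    + intros w Hw. symmetry. apply diff_quot_neq. intros ->.
      rewrite Cmod_minus_sym in Hw. lra.
Qed.

Definition rot (r t : R) : C := ((r * cos t)%R, (r * sin t)%R).

Lemma Cmod_rot (r t : R) : (0 <= r)%R -> Cmod (rot r t) = r.
Proof.
  intros Hr. unfold Cmod, rot; simpl.
  replace (r * cos t * (r * cos t * 1) + r * sin t * (r * sin t * 1))%R with (r * r)%R.
  - now apply sqrt_square.
  - assert (H := sin2_cos2 t). unfold Rsqr in H.
    replace (r * r)%R with (r * r * (sin t * sin t + cos t * cos t))%R by (rewrite H; ring). ring.
Qed.

Lemma rot_period (r : R) : rot r (2 * PI) = rot r 0.
Proof. unfold rot. now rewrite sin_2PI cos_2PI sin_0 cos_0. Qed.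

Lemma curve_rot (r t : R) : curve_deriv (rot r) t (Ci * rot r t).
Proof.
  replace (Ci * rot r t) with ((- (r * sin t))%R, (r * cos t)%R).
  - apply curve_deriv_pair; simpl; auto_derive; trivial; ring.
  - unfold Ci, rot, Cmult; simpl. f_equal; ring.
Qed.

Lemma curve_circle (p : C) (r t : R) : curve_deriv (fun s => p + rot r s) t (Ci * rot r t).
Proof.
  eapply (eq_ind_r (fun x => curve_deriv _ t x)).
  - apply (cderiv_curve (fun w => p + w) (rot r) t (0 + 1)); [|apply curve_rot].
    apply cderiv_plus; [apply cderiv_const|apply cderiv_id].
  - ring.
Qed.

Lemma Rcont_rot (r : R) : Rcont (rot r).
Proof. intros t. exact (curve_cont _ _ _ (curve_rot r t)). Qed.

Lemma Rcont_circle (p : C) (r : R) : Rcont (fun t => p + rot r t).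
Proof. intros t. exact (curve_cont _ _ _ (curve_circle p r t)). Qed.

Lemma circle_far (p z : C) (r t : R) : (0 <= r)%R ->
  (r - Cmod (z - p) <= Cmod (p + rot r t - z))%R.
Proof.
  intros Hr. assert (H := Cmod_triangle (p + rot r t - z) (z - p)).
  replace (p + rot r t - z + (z - p)) with (rot r t) in H by ring.
  rewrite Cmod_rot // in H. lra.
Qed.

Lemma circle_neq (p z : C) (r t : R) : (Cmod (z - p) < r)%R -> p + rot r t - z <> 0.
Proof.
  intros H. apply Cmod_gt_0. assert (K := Cmod_ge_0 (z - p)).
  assert (F := circle_far p z r t ltac:(lra)). lra.
Qed.

Lemma Rcont_bounded (g : R -> C) (a b : R) : (a <= b)%R -> Rcont g ->
  exists B, (0 <= B)%R /\ forall t, (a <= t <= b)%R -> (Cmod (g t) <= B)%R.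
Proof.
  intros Hab Hg. destruct (continuity_ab_maj (fun t => Cmod (g t)) a b Hab) as [x [Hx _]].
  - intros t _. apply continuity_pt_filterlim. apply ccont_Cmod, Hg.
  - exists (Cmod (g x)). split; [apply Cmod_ge_0|]. exact Hx.
Qed.

(** For e = 1/(zeta - z) and e' = 1/(zeta - z - h) this is the first-order expansion
    of 1/(zeta - z)^n in z with a remainder of order |h|^2 that is uniform in zeta, which is what
    differentiation under the integral sign requires. *)
Lemma inv_pow_taylor (n : nat) (e e' h : C) (M : R) :
  e' - e = h * e * e' -> (Cmod e <= M)%R -> (Cmod e' <= M)%R ->
  (Cmod (e' ^ n - e ^ n - h * (INR n * e ^ S n)) <=
     Cmod h * Cmod h * (INR n * INR (S n) * M ^ (n + 2)))%R.
Proof.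
  intros E H1 H2. assert (P0 := Cmod_ge_0 e).
  assert (HM : forall k, (0 <= M ^ k)%R) by (intros; apply pow_le; lra).
  assert (Hp : forall k, (Cmod (e ^ k) <= M ^ k)%R)
    by (intros k; rewrite Cmod_pow; apply pow_incr; lra).
  induction n as [|n IH].
  - simpl INR. replace (e' ^ 0 - e ^ 0 - h * (0 * e ^ 1)) with (RtoC 0) by (simpl; ring).
    rewrite Cmod_0. simpl. lra.
  - set (A := e' ^ n - e ^ n - h * (INR n * e ^ S n)) in *.
    replace (e' ^ S n - e ^ S n - h * (INR (S n) * e ^ S (S n))) with
      (e' * A + (h * h) * (e ^ S (S n) * e') + (h * h) * (INR n * (e ^ S (S n) * e'))).
    2:{ unfold A. rewrite S_INR RtoC_plus. simpl Cpow.
      assert (Z : e' - e - h * e * e' = 0) by (rewrite E; ring).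
      generalize (e ^ n) (e' ^ n) (RtoC (INR n)). intros X Y N.
      transitivity (e' * Y - e * X - h * ((N + 1) * (e * (e * X))) - (X + (N + 1) * X * h * e) * (e' - e - h * e * e'));
        [ring|rewrite Z; ring]. }
    assert (Q : (Cmod (e ^ S (S n) * e') <= M ^ (n + 3))%R).
    { rewrite Cmod_mult. replace (n + 3)%nat with (S (S (S n))) by lia.
      rewrite -(tech_pow_Rmult M (S (S n))) Rmult_comm.
      apply Rmult_le_compat; try apply Cmod_ge_0; [exact H2|apply Hp]. }
    assert (Hh := Cmod_ge_0 h). assert (Hn := pos_INR n).
    eapply Rle_trans; [apply Cmod_triangle|].
    eapply Rle_trans; [apply Rplus_le_compat_r, Cmod_triangle|].
    rewrite !(Cmod_mult (h * h)) (Cmod_mult h h) (Cmod_mult e' A) (Cmod_mult (INR n)) Cmod_R.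
    rewrite (Rabs_pos_eq (INR n)) //.
    set (q := Cmod (e ^ S (S n) * e')) in *. set (k := (Cmod h * Cmod h)%R) in *.
    assert (Hk : (0 <= k)%R) by (unfold k; nra).
    assert (HA : (Cmod e' * Cmod A <= k * (INR n * INR (S n) * M ^ (n + 3)))%R).
    { replace (n + 3)%nat with (S (n + 2)) by lia. simpl pow.
      replace (k * (INR n * INR (S n) * (M * M ^ (n + 2))))%R with
        (M * (k * (INR n * INR (S n) * M ^ (n + 2))))%R by ring.
      apply Rmult_le_compat; try apply Cmod_ge_0; [exact H2|exact IH]. }
    replace (S n + 2)%nat with (n + 3)%nat by lia.
    set (m := (M ^ (n + 3))%R) in *. rewrite !S_INR in HA |- *.
    assert (HQ1 : (k * q <= k * m)%R) by now apply Rmult_le_compat_l.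
    assert (HQ2 : (k * (INR n * q) <= k * (INR n * m))%R)
      by (apply Rmult_le_compat_l; [exact Hk|]; now apply Rmult_le_compat_l).
    assert (Hm : (0 <= k * m)%R) by (apply Rmult_le_pos; [exact Hk|apply HM]).
    assert (Hm' : (0 <= INR n * (k * m))%R) by now apply Rmult_le_pos.
    lra.
Qed.

(** With zeta = p + rot r t this is the integral of psi(t) / (zeta - z)^n over [0, 2 PI].
    The factor zeta' = i (zeta - p) of a contour integral is left to psi. *)
Definition kernel_int (p : C) (r : R) (psi : R -> C) (n : nat) (z : C) : C :=
  Cint (fun t => psi t * (/ (p + rot r t - z)) ^ n) 0 (2 * PI).

Lemma Rcont_pow (g : R -> C) (n : nat) : Rcont g -> Rcont (fun t => g t ^ n).
Proof.
  intros Hg t. induction n as [|n IH]; simpl; [apply ccont_const|].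
  apply ccont_mult; [apply Hg|exact IH].
Qed.

Lemma Rcont_kernel (p z : C) (r : R) (psi : R -> C) (n : nat) : Rcont psi ->
  (Cmod (z - p) < r)%R -> Rcont (fun t => psi t * (/ (p + rot r t - z)) ^ n).
Proof.
  intros Hpsi Hz t. apply ccont_mult; [apply Hpsi|].
  apply (Rcont_pow (fun t => / (p + rot r t - z))). intros s.
  apply ccont_inv; [now apply circle_neq|].
  apply ccont_minus; [apply Rcont_circle|apply ccont_const].
Qed.

Lemma kernel_int_deriv (p z : C) (r : R) (psi : R -> C) (n : nat) : Rcont psi ->
  (Cmod (z - p) < r)%R ->
  cderiv (kernel_int p r psi n) z (INR n * kernel_int p r psi (S n) z).
Proof.
  intros Hpsi Hz. assert (HPI := PI_RGT_0).
  destruct (Rcont_bounded psi 0 (2 * PI) ltac:(lra) Hpsi) as [B [HB0 HB]].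
  assert (Hr : (0 <= r)%R) by (generalize (Cmod_ge_0 (z - p)); lra).
  set (d := (r - Cmod (z - p))%R). assert (Hd : (0 < d)%R) by (unfold d; lra).
  set (M := (2 / d)%R). assert (HM : (0 < M)%R) by (apply Rdiv_lt_0_compat; lra).
  set (K := (B * (INR n * INR (S n) * M ^ (n + 2)))%R).
  assert (HK : (0 <= K)%R).
  { apply Rmult_le_pos; [exact HB0|]. apply Rmult_le_pos; [|apply pow_le; lra].
    apply Rmult_le_pos; apply pos_INR. }
  apply cderiv_eps. intros eps He.
  set (T := (2 * PI * K + 1)%R).
  assert (HT0 : (0 < T)%R) by (unfold T; nra).
  exists (Rmin (d / 2) (eps / T)). split.
  { apply Rmin_pos; [lra|]. now apply Rdiv_lt_0_compat. }
  intros w Hw. assert (Hw1 := Rlt_le_trans _ _ _ Hw (Rmin_l _ _)).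
  assert (Hw2 := Rlt_le_trans _ _ _ Hw (Rmin_r _ _)).
  assert (Hwz : (Cmod (w - p) <= Cmod (z - p) + d / 2)%R).
  { replace (w - p) with ((w - z) + (z - p)) by ring.
    eapply Rle_trans; [apply Cmod_triangle|]. lra. }
  assert (Hwr : (Cmod (w - p) < r)%R) by (unfold d in *; lra).
  set (D := fun t => psi t * (/ (p + rot r t - w)) ^ n - psi t * (/ (p + rot r t - z)) ^ n -
     ((w - z) * INR n) * (psi t * (/ (p + rot r t - z)) ^ S n)).
  assert (Hc1 := Rcont_kernel p w r psi n Hpsi Hwr).
  assert (Hc2 := Rcont_kernel p z r psi n Hpsi Hz).
  assert (Hc3 := Rcont_kernel p z r psi (S n) Hpsi Hz).
  assert (Hc4 : Rcont (fun t => ((w - z) * INR n) * (psi t * (/ (p + rot r t - z)) ^ S n)))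
    by (intros t; apply ccont_mult; [apply ccont_const|apply Hc3]).
  assert (Hc5 : Rcont (fun t => psi t * (/ (p + rot r t - w)) ^ n - psi t * (/ (p + rot r t - z)) ^ n))
    by (intros t; apply ccont_minus; [apply Hc1|apply Hc2]).
  replace (kernel_int p r psi n w - kernel_int p r psi n z -
    (w - z) * (INR n * kernel_int p r psi (S n) z)) with (Cint D 0 (2 * PI)).
  2:{ unfold D. rewrite Cint_minus // Cint_minus // Cint_mult_l //. unfold kernel_int. ring. }
  assert (HD : Rcont D) by (intros t; apply ccont_minus; [apply Hc5|apply Hc4]).
  eapply Rle_trans; [apply (Cint_bound D 0 (2 * PI) (Cmod (w - z) * Cmod (w - z) * K)); [exact HD|lra|]|].
  - intros t Ht. unfold D.
    set (e := / (p + rot r t - z)). set (e' := / (p + rot r t - w)).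
    replace (psi t * e' ^ n - psi t * e ^ n - (w - z) * INR n * (psi t * e ^ S n)) with
      (psi t * (e' ^ n - e ^ n - (w - z) * (INR n * e ^ S n))) by (simpl Cpow; ring).
    rewrite Cmod_mult.
    assert (Bd : forall u, (Cmod (u - p) < r)%R -> (d / 2 <= r - Cmod (u - p))%R ->
       (Cmod (/ (p + rot r t - u)) <= M)%R).
    { intros u Hu Hu2. rewrite Cmod_inv; [|now apply circle_neq].
      replace M with (/ (d / 2))%R by (unfold M; field; lra).
      apply Rinv_le_contravar; [lra|]. eapply Rle_trans; [exact Hu2|]. now apply circle_far. }
    assert (H := inv_pow_taylor n e e' (w - z) M).
    unfold K. replace (Cmod (w - z) * Cmod (w - z) * (B * (INR n * INR (S n) * M ^ (n + 2))))%R with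
      (B * (Cmod (w - z) * Cmod (w - z) * (INR n * INR (S n) * M ^ (n + 2))))%R by ring.
    apply Rmult_le_compat; try apply Cmod_ge_0; [now apply HB|]. apply H.
    + unfold e, e'. assert (N1 := circle_neq p z r t Hz). assert (N2 := circle_neq p w r t Hwr).
      field. auto.
    + apply Bd; unfold d in *; lra.
    + apply Bd; unfold d in *; lra.
  - assert (HwT : (Cmod (w - z) * T <= eps)%R).
    { apply (Rmult_lt_compat_r T) in Hw2; [|exact HT0].
      replace (eps / T * T)%R with eps in Hw2 by (field; lra). lra. }
    assert (H0 := Cmod_ge_0 (w - z)).
    assert (HwT2 : (Cmod (w - z) * (Cmod (w - z) * T) <= Cmod (w - z) * eps)%R)
      by now apply Rmult_le_compat_l.
    unfold T in HwT2. nra.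
Qed.

Lemma Cint_full_turn (p : C) (r : R) (G g : C -> C) : (forall z, cderiv G z (g z)) -> cont g ->
  Cint (fun t => g (p + rot r t) * rot r t) 0 (2 * PI) = 0.
Proof.
  intros HG Hg.
  assert (Hc : Rcont (fun t => g (p + rot r t) * rot r t)).
  { intros t. apply ccont_mult; [|apply Rcont_rot].
    apply (Rcont_comp g (fun t => p + rot r t)); [exact Hg|apply Rcont_circle]. }
  assert (H : Ci * Cint (fun t => g (p + rot r t) * rot r t) 0 (2 * PI) = 0).
  { rewrite -Cint_mult_l //.
    rewrite (Cint_deriv (fun t => G (p + rot r t))).
    - cbv beta. rewrite rot_period. ring.
    - intros t. eapply (eq_ind_r (fun x => curve_deriv _ t x)).
      + apply cderiv_curve; [apply HG|apply curve_circle].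
      + ring.
    - intros t. apply ccont_mult; [apply ccont_const|apply Hc]. }
  replace (Cint (fun t => g (p + rot r t) * rot r t) 0 (2 * PI)) with
    (/ Ci * (Ci * Cint (fun t => g (p + rot r t) * rot r t) 0 (2 * PI)))
    by (field; exact Ci_nz).
  rewrite H. ring.
Qed.

(** The derivative in z is the integral of (zeta - p) / (zeta - z)^2, whose integrand is
    up to a constant the derivative of 1/(zeta - z) along the circle.  So the derivative in z is 0 and
    the value is the one at the centre. *)
Lemma winding_integral (p z : C) (r : R) : (Cmod (z - p) < r)%R ->
  kernel_int p r (rot r) 1 z = RtoC (2 * PI).
Proof.
  intros Hz. assert (Hr : (0 < r)%R) by (generalize (Cmod_ge_0 (z - p)); lra).
  assert (Z : forall w, (Cmod (w - p) < r)%R -> kernel_int p r (rot r) 2 w = 0).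
  { intros w Hw. assert (Hc := Rcont_kernel p w r (rot r) 2 (Rcont_rot r) Hw).
    assert (H : (- Ci) * kernel_int p r (rot r) 2 w = 0).
    { unfold kernel_int. rewrite -Cint_mult_l //.
      rewrite (Cint_deriv (fun t => / (p + rot r t - w))).
      - cbv beta. rewrite rot_period. ring.
      - intros t. assert (N := circle_neq p w r t Hw).
        eapply (eq_ind_r (fun x => curve_deriv _ t x)).
        + apply (cderiv_curve (fun u => / (u - w)) (fun t => p + rot r t)); [|apply curve_circle].
          apply (cderiv_inv (fun u => u - w)); [exact N|].
          apply cderiv_minus; [apply cderiv_id|apply cderiv_const].
        + cbv beta. simpl Cpow. field. exact N.
      - intros t. apply ccont_mult; [apply ccont_const|apply Hc]. }
    replace (kernel_int p r (rot r) 2 w) with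
      (/ (- Ci) * (- Ci * kernel_int p r (rot r) 2 w)) by (field; exact Ci_nz).
    rewrite H. ring. }
  set (h := fun t : R => kernel_int p r (rot r) 1 (p + t * (z - p))).
  assert (E : h 0%R = h 1%R).
  { apply (@eq_is_derive C_R_NormedModule); [|lra]. intros t Ht.
    assert (Hin : (Cmod (p + t * (z - p) - p) < r)%R).
    { replace (p + t * (z - p) - p) with (t * (z - p)) by ring.
      rewrite Cmod_mult Cmod_R Rabs_pos_eq; [|lra]. generalize (Cmod_ge_0 (z - p)). nra. }
    change (curve_deriv h t (RtoC 0)). eapply (eq_ind_r (fun x => curve_deriv _ t x)).
    - apply cderiv_curve; [apply kernel_int_deriv; [apply Rcont_rot|exact Hin]|apply curve_line].
    - rewrite Z //. ring. }
  unfold h in E. replace (p + 1 * (z - p)) with z in E by ring.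
  replace (p + 0 * (z - p)) with p in E by ring. rewrite -E. unfold kernel_int.
  rewrite (Cint_ext _ (fun _ => 1)).
  - rewrite Cint_const Rminus_0_r. ring.
  - intros t. simpl Cpow. assert (N : rot r t <> 0) by (apply Cmod_gt_0; rewrite Cmod_rot; lra).
    replace (p + rot r t - p) with (rot r t) by ring. field. exact N.
Qed.

(** The difference quotient of F at z is entire, so it has a primitive and its integral
    over a circle vanishes.  This equates the Cauchy integral of F with F(z) times the integral of
    [winding_integral]. *)
Lemma cauchy_formula (F f : C -> C) (p z : C) (r : R) :
  (forall w, cderiv F w (f w)) -> entire f -> (Cmod (z - p) < r)%R ->
  RtoC (2 * PI) * F z = kernel_int p r (fun t => F (p + rot r t) * rot r t) 1 z.
Proof.
  intros HF Hf Hz. assert (Hr : (0 < r)%R) by (generalize (Cmod_ge_0 (z - p)); lra).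
  assert (Hg := diff_quot_entire F f z HF Hf).
  destruct (primitive_exists _ Hg) as [G HG].
  assert (H := Cint_full_turn p r G _ HG (ex_deriv_cont _ Hg)).
  assert (HcF : cont F) by (apply ex_deriv_cont; intros w; exists (f w); apply HF).
  assert (Hpsi : Rcont (fun t => F (p + rot r t) * rot r t)).
  { intros t. apply ccont_mult; [|apply Rcont_rot].
    apply (Rcont_comp F (fun t => p + rot r t)); [exact HcF|apply Rcont_circle]. }
  rewrite -(winding_integral p z r Hz).
  assert (H1 := Rcont_kernel p z r _ 1 Hpsi Hz).
  assert (H2 := Rcont_kernel p z r _ 1 (Rcont_rot r) Hz).
  assert (H3 : Rcont (fun t => F z * (rot r t * (/ (p + rot r t - z)) ^ 1)))
    by (intros t; apply ccont_mult; [apply ccont_const|apply H2]).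
  rewrite (Cint_ext _ (fun t => F (p + rot r t) * rot r t * (/ (p + rot r t - z)) ^ 1 -
     F z * (rot r t * (/ (p + rot r t - z)) ^ 1))) in H.
  - rewrite Cint_minus // Cint_mult_l // in H.
    fold (kernel_int p r (rot r) 1 z) in H.
    fold (kernel_int p r (fun t => F (p + rot r t) * rot r t) 1 z) in H.
    set (X := kernel_int p r (fun t => F (p + rot r t) * rot r t) 1 z) in *.
    set (Y := kernel_int p r (rot r) 1 z) in *.
    replace X with (X - F z * Y + F z * Y) by ring. rewrite H. ring.
  - intros t. assert (N := circle_neq p z r t Hz).
    rewrite diff_quot_neq; [|intros E; apply N; rewrite E; ring].
    simpl Cpow. field. exact N.
Qed.

(** Cauchy's formula applies to the primitive F of f and exhibits it as a kernel
    integral near p; differentiating three times under the integral sign gives F' = f, F'' = f1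
    and the derivative of f1. *)
Lemma entire_deriv (f f1 : C -> C) : (forall z, cderiv f z (f1 z)) -> entire f1.
Proof.
  intros Hf p.
  assert (He : entire f) by (intros z; exists (f1 z); apply Hf).
  destruct (primitive_exists f He) as [F HF].
  set (psi := fun t => F (p + rot 1 t) * rot 1 t).
  assert (Hpsi : Rcont psi).
  { intros t. apply ccont_mult; [|apply Rcont_rot].
    apply (Rcont_comp F (fun t => p + rot 1 t)); [|apply Rcont_circle].
    apply ex_deriv_cont; intros w; exists (f w); apply HF. }
  assert (HPI : RtoC (2 * PI) <> 0).
  { intros E. apply RtoC_inj in E. generalize PI_RGT_0. lra. }
  set (q := / RtoC (2 * PI)).
  assert (step : forall g g' n c, (forall z, cderiv g z (g' z)) ->
     (forall z, (Cmod (z - p) < 1)%R -> g z = c * kernel_int p 1 psi n z) ->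
     forall z, (Cmod (z - p) < 1)%R -> g' z = c * INR n * kernel_int p 1 psi (S n) z).
  { intros g g' n c Hg E z Hz. apply (cderiv_unique g z _ _ (Hg z)).
    apply (cderiv_ext_loc (fun w => c * kernel_int p 1 psi n w) g z _ (1 - Cmod (z - p))); [lra| |].
    - intros w Hw. symmetry. apply E.
      replace (w - p) with ((w - z) + (z - p)) by ring.
      eapply Rle_lt_trans; [apply Cmod_triangle|]. lra.
    - eapply cderiv_eq.
      + apply cderiv_mult; [apply cderiv_const|]. apply kernel_int_deriv; [exact Hpsi|exact Hz].
      + cbv beta. ring. }
  assert (E0 : forall z, (Cmod (z - p) < 1)%R -> F z = q * kernel_int p 1 psi 1 z).
  { intros z Hz. rewrite -(cauchy_formula F f p z 1 HF He Hz). unfold q. field. exact HPI. }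
  assert (E1 := step F f 1%nat q HF E0).
  assert (E2 := step f f1 2%nat _ Hf E1).
  eexists. eapply (cderiv_ext_loc _ f1 p _ 1); [lra| |].
  - intros w Hw. symmetry. now apply E2.
  - apply cderiv_mult; [apply cderiv_const|]. apply kernel_int_deriv; [exact Hpsi|].
    replace (p - p) with (RtoC 0) by ring. rewrite Cmod_0. lra.
Qed.

(** * Zeros of entire functions *)

Lemma entire_cderiv (f : C -> C) : entire f -> forall z, cderiv f z (C_derive f z).
Proof. intros Hf z. apply C_derive_correct; [exact z|apply Hf]. Qed.

Lemma cauchy_bound (f : C -> C) (p z : C) (r B : R) : entire f -> (Cmod (z - p) < r)%R ->
  (forall t, (0 <= t <= 2 * PI)%R -> (Cmod (f (p + rot r t)%C) <= B)%R) ->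
  (Cmod (f z) * (r - Cmod (z - p)) <= B * r)%R.
Proof.
  intros Hf Hz HB. assert (Hr : (0 < r)%R) by (generalize (Cmod_ge_0 (z - p)); lra).
  set (f1 := C_derive f). assert (Hf1 := entire_cderiv f Hf). fold f1 in Hf1.
  assert (H := cauchy_formula f f1 p z r Hf1 (entire_deriv f f1 Hf1) Hz).
  assert (HPI := PI_RGT_0).
  set (d := (r - Cmod (z - p))%R). assert (Hd : (0 < d)%R) by (unfold d; lra).
  assert (Hpsi : Rcont (fun t => f (p + rot r t) * rot r t)).
  { intros t. apply ccont_mult; [|apply Rcont_rot].
    apply (Rcont_comp f (fun t => p + rot r t)); [now apply ex_deriv_cont|apply Rcont_circle]. }
  assert (HK : (Cmod (kernel_int p r (fun t => f (p + rot r t) * rot r t)%C 1 z) <=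
     (2 * PI - 0) * (B * r / d))%R).
  { apply Cint_bound; [now apply Rcont_kernel|lra|]. intros t Ht.
    assert (N := circle_neq p z r t Hz).
    simpl Cpow. rewrite Cmult_1_r !Cmod_mult Cmod_inv // Cmod_rot; [|lra].
    assert (Hfar := circle_far p z r t ltac:(lra)). fold d in Hfar.
    unfold Rdiv. apply Rmult_le_compat.
    - apply Rmult_le_pos; [apply Cmod_ge_0|lra].
    - apply Rlt_le, Rinv_0_lt_compat; lra.
    - apply Rmult_le_compat_r; [lra|now apply HB].
    - apply Rinv_le_contravar; lra. }
  rewrite -H Cmod_mult Cmod_R Rabs_pos_eq in HK; [|lra].
  replace ((2 * PI - 0) * (B * r / d))%R with (2 * PI * (B * r / d))%R in HK by ring.
  apply Rmult_le_reg_l in HK; [|lra].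
  apply (Rmult_le_compat_r d) in HK; [|lra].
  replace (B * r / d * d)%R with (B * r)%R in HK by (field; lra). exact HK.
Qed.

Lemma entire_divide (f : C -> C) (p : C) : entire f -> f p = 0 ->
  exists g, entire g /\ forall z, f z = (z - p) * g z.
Proof.
  intros Hf Hp. destruct (choice _ Hf) as [f1 Hf1].
  exists (diff_quot f (f1 p) p). split.
  - apply diff_quot_entire; [exact Hf1|]. now apply (entire_deriv f).
  - intros z. destruct (excluded_middle_informative (z = p)) as [->|Hz].
    + rewrite Hp. ring.
    + rewrite diff_quot_neq // Hp. field. now apply Cminus_eq_contra.
Qed.

(** Let B bound |f| on the circle of radius r.  If the factor z - p could be split off
    n times for every n, the cofactor would be at most B / r^n on that circle, hence of that order inside by [cauchy_bound], and
    |f(z0)| would be at most a constant times (|z0 - p| / r)^n for every n. *)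
Lemma entire_factor (f : C -> C) (p : C) : entire f -> (exists z, f z <> 0) ->
  exists (m : nat) (g : C -> C), entire g /\ g p <> 0 /\ forall z, f z = (z - p) ^ m * g z.
Proof.
  intros Hf [z0 Hz0].
  destruct (classic (exists (m : nat) (g : C -> C),
     entire g /\ g p <> 0 /\ forall z, f z = (z - p) ^ m * g z)) as [H|H]; [exact H|exfalso].
  assert (Hn : forall n : nat, exists g, entire g /\ forall z, f z = (z - p) ^ n * g z).
  { induction n as [|n [g [Hg Eg]]].
    - exists f. split; [exact Hf|]. intros z. simpl. ring.
    - destruct (classic (g p = 0)) as [G0|G0].
      + destruct (entire_divide g p Hg G0) as [k [Hk Ek]]. exists k. split; [exact Hk|].
        intros z. rewrite Eg Ek. simpl. ring.
      + exfalso. apply H. now exists n, g. }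
  set (s := Cmod (z0 - p)). assert (Hs := Cmod_ge_0 (z0 - p)). fold s in Hs.
  (* This radius makes the ratio |z0 - p| / r smaller than 1/2. *)
  set (r := (2 * s + 1)%R). assert (Hr : (0 < r)%R) by (unfold r; lra).
  destruct (Rcont_bounded (fun t => f (p + rot r t)) 0 (2 * PI)) as [B [HB0 HB]].
  { generalize PI_RGT_0; lra. }
  { apply (Rcont_comp f (fun t => p + rot r t)); [now apply ex_deriv_cont|apply Rcont_circle]. }
  assert (Hb : forall n, (Cmod (f z0) <= 2 * B * (/ 2) ^ n)%R).
  { intros n. destruct (Hn n) as [g [Hg Eg]].
    assert (Hrn : (0 < r ^ n)%R) by now apply pow_lt.
    assert (K := cauchy_bound g p z0 r (B / r ^ n) Hg ltac:(unfold r; fold s; lra)).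
    fold s in K.
    assert (K' : (Cmod (g z0) * (r - s) <= B / r ^ n * r)%R).
    { apply K. intros t Ht. specialize (HB t Ht). rewrite Eg Cmod_mult Cmod_pow in HB.
      replace (p + rot r t - p) with (rot r t) in HB by ring. rewrite Cmod_rot in HB; [|lra].
      apply (Rmult_le_reg_l (r ^ n)); [exact Hrn|].
      replace (r ^ n * (B / r ^ n))%R with B by (field; lra). exact HB. }
    assert (G0 := Cmod_ge_0 (g z0)).
    assert (Hq : (Cmod (g z0) <= 2 * (B / r ^ n))%R).
    { apply (Rmult_le_reg_r (r / 2)); [lra|].
      eapply Rle_trans; [|eapply Rle_trans; [exact K'|right; field; lra]].
      apply Rmult_le_compat_l; [exact G0|]. unfold r. lra. }
    rewrite Eg Cmod_mult Cmod_pow. fold s.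
    apply Rle_trans with ((r / 2) ^ n * (2 * (B / r ^ n)))%R.
    - apply Rmult_le_compat; [now apply pow_le|exact G0| |exact Hq].
      apply pow_incr. unfold r. lra.
    - right. unfold Rdiv. rewrite Rpow_mult_distr. field. lra. }
  assert (P := proj1 (Cmod_gt_0 _) Hz0).
  assert (Hg := is_lim_seq_geom (/2) ltac:(rewrite Rabs_pos_eq; lra)).
  assert (Hg' : is_lim_seq (fun n => (2 * B) * (/2) ^ n)%R (2 * B * 0)%R)
    by (apply: (is_lim_seq_scal_l _ (2 * B) 0 Hg)).
  rewrite Rmult_0_r in Hg'.
  destruct (proj2 (is_lim_seq_spec _ _) Hg' (mkposreal _ P)) as [N HN].
  specialize (HN N (le_n N)). simpl in HN. specialize (Hb N).
  apply Rabs_def2 in HN. lra.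
Qed.

Lemma cderiv_pow_shift (p z : C) (m : nat) : exists D,
  cderiv (fun w => (w - p) ^ m) z D /\ (z - p) * D = INR m * (z - p) ^ m.
Proof.
  induction m as [|m [D [HD ED]]].
  - exists 0. split; [exact (cderiv_const 1 z)|]. simpl. ring.
  - exists ((1 - 0) * (z - p) ^ m + (z - p) * D). split.
    + simpl Cpow. apply (cderiv_mult (fun w => w - p) (fun w => (w - p) ^ m)); [|exact HD].
      apply cderiv_minus; [apply cderiv_id|apply cderiv_const].
    + rewrite ED S_INR RtoC_plus. simpl Cpow. ring.
Qed.

Lemma cont_away_from_zero (g : C -> C) (p : C) : cont g -> g p <> 0 ->
  exists d, (0 < d)%R /\ forall w, (Cmod (w - p) < d)%R -> (Cmod (g p) / 2 <= Cmod (g w))%R.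
Proof.
  intros Hg Hp. assert (P := proj1 (Cmod_gt_0 _) Hp).
  destruct (ccont_delta g p (Cmod (g p) / 2) (Hg p) ltac:(lra)) as [d [Hd Hb]].
  exists d. split; [exact Hd|]. intros w Hw. specialize (Hb w Hw).
  assert (T := Cmod_triangle (g p - g w) (g w)).
  replace (g p - g w + g w) with (g p) in T by ring. rewrite Cmod_minus_sym in T. lra.
Qed.

Lemma cont_bounded_near (g : C -> C) (p : C) : cont g ->
  exists d, (0 < d)%R /\ forall w, (Cmod (w - p) < d)%R -> (Cmod (g w) <= Cmod (g p) + 1)%R.
Proof.
  intros Hg. destruct (ccont_delta g p 1 (Hg p) ltac:(lra)) as [d [Hd Hb]].
  exists d. split; [exact Hd|]. intros w Hw. specialize (Hb w Hw).
  assert (T := Cmod_triangle (g w - g p) (g p)).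
  replace (g w - g p + g p) with (g w) in T by ring. lra.
Qed.

(** The logarithmic derivative f'/f has at most simple poles: for f = (z - p)^m g one
    has (z - p) f' = (z - p)^m (m g + (z - p) g'). *)
Lemma log_deriv_bound (f f1 : C -> C) (p : C) : (forall z, cderiv f z (f1 z)) ->
  (exists z, f z <> 0) ->
  exists d K, (0 < d)%R /\ (0 <= K)%R /\ forall w, (Cmod (w - p) < d)%R ->
    (Cmod (w - p) * Cmod (f1 w) <= K * Cmod (f w))%R.
Proof.
  intros Hf Hnz. assert (He : entire f) by (intros z; exists (f1 z); apply Hf).
  destruct (entire_factor f p He Hnz) as [m [g [Hg [Hgp Eg]]]].
  set (g1 := C_derive g). assert (Hg1 := entire_cderiv g Hg). fold g1 in Hg1. assert (Hge := entire_deriv g g1 Hg1).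
  destruct (cont_away_from_zero g p (ex_deriv_cont g Hg) Hgp) as [d1 [Hd1 B1]].
  destruct (cont_bounded_near g p (ex_deriv_cont g Hg)) as [d2 [Hd2 B2]].
  destruct (cont_bounded_near g1 p (ex_deriv_cont g1 Hge)) as [d3 [Hd3 B3]].
  set (M := (INR m * (Cmod (g p) + 1) + (Cmod (g1 p) + 1))%R).
  assert (P := proj1 (Cmod_gt_0 _) Hgp).
  assert (HM : (0 <= M)%R).
  { unfold M. generalize (pos_INR m) (Cmod_ge_0 (g1 p)). nra. }
  exists (Rmin 1 (Rmin d1 (Rmin d2 d3))), (M / (Cmod (g p) / 2))%R.
  split; [repeat apply Rmin_pos; lra|]. split; [apply Rmult_le_pos; [exact HM|]; apply Rlt_le, Rinv_0_lt_compat; lra|].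
  intros w Hw.
  assert (W0 := Rlt_le_trans _ _ _ Hw (Rmin_l _ _)).
  assert (W' := Rlt_le_trans _ _ _ Hw (Rmin_r _ _)).
  assert (W1 := Rlt_le_trans _ _ _ W' (Rmin_l _ _)).
  assert (W'' := Rlt_le_trans _ _ _ W' (Rmin_r _ _)).
  assert (W2 := Rlt_le_trans _ _ _ W'' (Rmin_l _ _)).
  assert (W3 := Rlt_le_trans _ _ _ W'' (Rmin_r _ _)).
  specialize (B1 w W1). specialize (B2 w W2). specialize (B3 w W3).
  destruct (cderiv_pow_shift p w m) as [D [HD ED]].
  assert (E : f1 w = D * g w + (w - p) ^ m * g1 w).
  { apply (cderiv_unique f w); [apply Hf|].
    apply (cderiv_ext_loc (fun w => (w - p) ^ m * g w) f w _ 1); [lra|intros u _; now rewrite Eg|].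
    apply (cderiv_mult (fun w => (w - p) ^ m)); [exact HD|apply Hg1]. }
  rewrite -Cmod_mult E.
  replace ((w - p) * (D * g w + (w - p) ^ m * g1 w)) with
    ((w - p) ^ m * (INR m * g w + (w - p) * g1 w)).
  2:{ transitivity ((INR m * (w - p) ^ m) * g w + (w - p) ^ m * (w - p) * g1 w); [ring|].
      rewrite -ED. ring. }
  rewrite Eg !Cmod_mult.
  replace (M / (Cmod (g p) / 2) * (Cmod ((w - p) ^ m) * Cmod (g w)))%R with
    (Cmod ((w - p) ^ m) * (M * (Cmod (g w) / (Cmod (g p) / 2))))%R by (field; lra).
  apply Rmult_le_compat_l; [apply Cmod_ge_0|].
  apply Rle_trans with M.
  - eapply Rle_trans; [apply Cmod_triangle|]. rewrite !Cmod_mult Cmod_R.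
    rewrite Rabs_pos_eq; [|apply pos_INR]. unfold M. apply Rplus_le_compat.
    + apply Rmult_le_compat_l; [apply pos_INR|exact B2].
    + generalize (Cmod_ge_0 (g1 w)) (Cmod_ge_0 (w - p)). nra.
  - rewrite -{1}(Rmult_1_r M). apply Rmult_le_compat_l; [exact HM|].
    apply (Rmult_le_reg_r (Cmod (g p) / 2)); [lra|].
    unfold Rdiv at 3. rewrite Rmult_assoc Rinv_l; lra.
Qed.

Lemma entire_zero_near (f : C -> C) (p : C) (r : R) : entire f -> (0 < r)%R ->
  (forall w, (Cmod (w - p) < r)%R -> f w = 0) -> forall z, f z = 0.
Proof.
  intros Hf Hr H0 z. destruct (classic (f z = 0)) as [E|E]; [exact E|exfalso].
  destruct (entire_factor f p Hf (ex_intro _ z E)) as [m [g [Hg [Hgp Eg]]]].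
  destruct (cont_away_from_zero g p (ex_deriv_cont g Hg) Hgp) as [d [Hd Hb]].
  set (e := (Rmin r d / 2)%R). assert (He : (0 < Rmin r d)%R) by now apply Rmin_pos.
  assert (M : Cmod (p + e - p) = e).
  { replace (p + e - p) with (RtoC e) by ring. rewrite Cmod_R Rabs_pos_eq; unfold e; lra. }
  assert (L1 := Rmin_l r d). assert (L2 := Rmin_r r d).
  assert (Z := H0 (p + e) ltac:(rewrite M; unfold e; lra)).
  specialize (Hb (p + e) ltac:(rewrite M; unfold e; lra)).
  assert (P := proj1 (Cmod_gt_0 _) Hgp).
  apply (f_equal Cmod) in Z. rewrite Eg Cmod_mult Cmod_pow M Cmod_0 in Z.
  assert (0 < e ^ m)%R by (apply pow_lt; unfold e; lra). nra.
Qed.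

Lemma deriv_zero_const (f : C -> C) : (forall z, cderiv f z 0) -> forall z, f z = f 0.
Proof.
  intros H z. assert (S := seg_deriv f (fun _ => 0) 0 z H (fun u => ccont_const 0 u)).
  unfold seg_int in S. rewrite Cint_const in S.
  replace (f z) with (f z - f 0 + f 0) by ring. rewrite -S. ring.
Qed.

Local Close Scope C_scope.
Local Open Scope R_scope.
(** * Second derivatives along lines *)

(** The Laplacian of a function u of a complex variable at z is the sum of these second
    derivatives d2 for t |-> u (z + t e) with e = 1 and e = i. *)
Definition second_deriv (phi : R -> R) (d1 d2 : R) : Prop :=
  exists phi1 : R -> R,
    locally 0 (fun t => is_derive phi t (phi1 t)) /\ phi1 0 = d1 /\ is_derive phi1 0 d2.

Lemma second_deriv_eq (phi : R -> R) (d1 d2 d1' d2' : R) :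
  second_deriv phi d1 d2 -> d1 = d1' -> d2 = d2' -> second_deriv phi d1' d2'.
Proof. now intros H <- <-. Qed.

Lemma second_deriv_ext_loc (phi psi : R -> R) (d1 d2 : R) :
  locally 0 (fun t => phi t = psi t) -> second_deriv phi d1 d2 -> second_deriv psi d1 d2.
Proof.
  intros E [phi1 [H1 [H2 H3]]]. exists phi1. split; [|now split].
  generalize (filter_and _ _ (locally_locally _ _ E) H1). apply filter_imp.
  intros t [Et Ht]. exact (is_derive_ext_loc _ _ _ _ Et Ht).
Qed.

Lemma second_deriv_plus (phi psi : R -> R) (a1 a2 b1 b2 : R) :
  second_deriv phi a1 a2 -> second_deriv psi b1 b2 -> second_deriv (fun t => phi t + psi t) (a1 + b1) (a2 + b2).
Proof.
  intros [phi1 [H1 [H2 H3]]] [psi1 [K1 [K2 K3]]].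
  exists (fun t => phi1 t + psi1 t). split; [|split].
  - generalize (filter_and _ _ H1 K1). apply filter_imp. intros t [A B].
    exact (is_derive_plus _ _ _ _ _ A B).
  - now rewrite H2 K2.
  - exact (is_derive_plus _ _ _ _ _ H3 K3).
Qed.

Lemma second_deriv_comp (L L1 : R -> R) (phi : R -> R) (d1 d2 l2 : R) :
  (forall x, is_derive L x (L1 x)) -> is_derive L1 (phi 0) l2 -> second_deriv phi d1 d2 ->
  second_deriv (fun t => L (phi t)) (L1 (phi 0) * d1) (l2 * (d1 * d1) + L1 (phi 0) * d2).
Proof.
  intros HL HL1 [phi1 [H1 [H2 H3]]]. exists (fun t => L1 (phi t) * phi1 t). split; [|split].
  - revert H1. apply filter_imp. intros t Ht.
    rewrite Rmult_comm. exact (is_derive_comp L phi t _ _ (HL _) Ht).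
  - now rewrite H2.
  - assert (H0 := locally_singleton _ _ H1).
    assert (Hc := is_derive_comp L1 phi 0 _ _ HL1 H0).
    eapply (eq_ind _ (fun x => is_derive _ 0 x)).
    + exact (Derive.is_derive_mult _ _ _ _ _ Hc H3).
    + rewrite /scal /= /mult /= H2. ring.
Qed.

Lemma second_deriv_test (phi : R -> R) (d1 d2 : R) :
  second_deriv phi d1 d2 -> locally 0 (fun t => phi t <= phi 0) -> d2 <= 0.
Proof.
  intros [phi1 [H1 [H2 H3]]] Hmax.
  destruct (filter_and _ _ H1 Hmax) as [r Hr].
  assert (B : forall t, Rabs t < r -> is_derive phi t (phi1 t) /\ phi t <= phi 0).
  { intros t Ht. apply Hr. change (Rabs (t - 0) < r). now rewrite Rminus_0_r. }
  clear H1 Hmax. assert (Hr0 := cond_pos r).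
  assert (D0 : phi1 0 = 0).
  { assert (H0 := proj1 (B 0 ltac:(rewrite Rabs_R0; lra))).
    apply is_derive_Reals in H0.
    assert (pr : derivable_pt phi 0) by (now exists (phi1 0)).
    rewrite -(derive_pt_eq_0 _ _ _ pr H0).
    apply (deriv_maximum phi (- r) r 0 pr); [lra|lra|].
    intros x Hx1 Hx2. apply B. apply Rabs_def1; lra. }
  apply Rnot_lt_le. intros Hpos.
  apply is_derive_Reals in H3. destruct (H3 (d2 / 2) ltac:(lra)) as [d Hd].
  assert (Hd0 := cond_pos d).
  set (s := Rmin (d / 2) (r / 2)).
  assert (Hs : 0 < s) by (apply Rmin_pos; lra).
  assert (Hs1 : s <= d / 2) by apply Rmin_l. assert (Hs2 : s <= r / 2) by apply Rmin_r.
  (* A positive derivative of phi1 at 0 makes phi1 positive just to the right of 0, where phi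
     then increases. *)
  destruct (MVT_cor2 phi phi1 0 s Hs) as [c [E Hc]].
  { intros x Hx. apply is_derive_Reals, B. apply Rabs_def1; lra. }
  specialize (Hd c ltac:(lra) ltac:(rewrite Rabs_pos_eq; lra)).
  rewrite Rplus_0_l D0 Rminus_0_r in Hd. apply Rabs_def2 in Hd.
  assert (Hq : 0 < phi1 c).
  { replace (phi1 c) with (phi1 c / c * c) by (field; lra). apply Rmult_lt_0_compat; lra. }
  assert (Hle := proj2 (B s ltac:(rewrite Rabs_pos_eq; lra))).
  assert (0 < phi1 c * (s - 0)) by (apply Rmult_lt_0_compat; lra). lra.
Qed.

Lemma curve_cderiv_line (g g1 : C -> C) (z e : C) (t : R) : (forall w, cderiv g w (g1 w)) ->
  curve_deriv (fun s : R => g (z + s * e)%C) t (e * g1 (z + t * e))%C.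
Proof. intros Hg. apply (cderiv_curve g (fun s : R => z + s * e)%C); [apply Hg|apply curve_line]. Qed.

Lemma is_derive_ln_Cmod (h : R -> C) (t : R) (d : C) : curve_deriv h t d -> h t <> RtoC 0 ->
  is_derive (fun s => ln (Cmod (h s))) t (Re (d / h t)%C).
Proof.
  intros Hd Hn. assert (P := proj1 (Cmod_gt_0 _) Hn).
  assert (H1 := curve_deriv_Re _ _ _ Hd). assert (H2 := curve_deriv_Im _ _ _ Hd).
  assert (E : Cmod (h t) ^ 2 = Re (h t) ^ 2 + Im (h t) ^ 2) by apply Cmod2_alt.
  assert (P2 : 0 < Re (h t) ^ 2 + Im (h t) ^ 2) by (rewrite -E; now apply pow_lt).
  assert (HQ : is_derive (fun s => Re (h s) ^ 2 + Im (h s) ^ 2) t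
    (INR 2 * Re d * Re (h t) ^ 1 + INR 2 * Im d * Im (h t) ^ 1)).
  { apply: is_derive_plus; [exact (is_derive_pow _ 2 _ _ H1)|exact (is_derive_pow _ 2 _ _ H2)]. }
  assert (HS := is_derive_comp sqrt _ t _ _ (is_derive_sqrt (fun x => x) _ _ (is_derive_id _) P2) HQ).
  assert (HC : is_derive (fun s => Cmod (h s)) t ((Re d * Re (h t) + Im d * Im (h t)) / Cmod (h t))).
  { apply (is_derive_ext (fun s => sqrt (Re (h s) ^ 2 + Im (h s) ^ 2))).
    - intros s. reflexivity.
    - eapply (eq_ind _ (fun x => is_derive _ t x)); [exact HS|].
      rewrite /scal /= /mult /= /one /=.
      change (sqrt (Re (h t) * (Re (h t) * 1) + Im (h t) * (Im (h t) * 1))) with (Cmod (h t)).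
      field. lra. }
  eapply (eq_ind _ (fun x => is_derive _ t x)).
  - exact (is_derive_comp ln _ t _ _ (is_derive_ln _ P) HC).
  - rewrite /scal /= /mult /=.
    transitivity ((Re d * Re (h t) + Im d * Im (h t)) / Cmod (h t) ^ 2); [field; lra|].
    rewrite E. destruct d as [d1 d2], (h t) as [x y]. simpl in *. field.
    intros Z; lra.
Qed.

(** Along the direction e the first derivative of ln |g| is Re (e g'/g) and the second one
    Re (e^2 (g'/g)').  The latter has opposite signs for e = 1 and e = i: ln |g| is harmonic. *)
Lemma second_deriv_ln_Cmod (g g1 : C -> C) (z e g2 : C) : (forall w, cderiv g w (g1 w)) ->
  cderiv g1 z g2 -> g z <> RtoC 0 ->
  second_deriv (fun t => ln (Cmod (g (z + t * e)%C))) (Re (e * (g1 z / g z))%C)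
     (Re (e * e * ((g2 * g z - g1 z * g1 z) / (g z * g z)))%C).
Proof.
  intros Hg Hg1 Hn.
  assert (Hc : cont g) by (apply ex_deriv_cont; intros w; exists (g1 w); apply Hg).
  exists (fun t : R => Re (e * (g1 (z + t * e) / g (z + t * e)))%C).
  assert (Z : (z + 0 * e = z)%C) by ring.
  split; [|split].
  - assert (HL : @ccont R_UniformSpace (fun t : R => g (z + t * e)%C) 0) by now apply cont_seg.
    assert (N : locally 0 (fun t : R => Cmod (g (z + t * e)%C - g (z + 0 * e)%C)%C < Cmod (g z))).
    { apply (proj1 (ccont_eps (T := R_UniformSpace) _ _) HL). now apply Cmod_gt_0. }
    revert N. apply filter_imp. intros t Ht.
    assert (Hnt : g (z + t * e)%C <> RtoC 0).
    { intros E. rewrite E Z in Ht. replace (0 - g z)%C with (- g z)%C in Ht by ring.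
      rewrite Cmod_opp in Ht. lra. }
    replace (e * (g1 (z + t * e) / g (z + t * e)))%C with (e * g1 (z + t * e) / g (z + t * e))%C
      by (field; exact Hnt).
    apply (is_derive_ln_Cmod (fun s : R => g (z + s * e)%C)); [now apply curve_cderiv_line|exact Hnt].
  - now rewrite Z.
  - assert (HK : cderiv (fun w => e * (g1 w / g w))%C (z + 0 * e)%C
       (e * ((g2 * g z - g1 z * g1 z) / (g z * g z)))%C).
    { rewrite Z. eapply cderiv_eq.
      - apply cderiv_mult; [apply cderiv_const|]. apply cderiv_div; [exact Hn|exact Hg1|apply Hg].
      - cbv beta. ring. }
    assert (HR := curve_deriv_Re _ _ _ (cderiv_curve _ (fun s : R => z + s * e)%C 0 _ _ HK (curve_line z e 0))).
    eapply (eq_ind _ (fun x => is_derive _ 0 x)); [exact HR|]. f_equal. ring.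
Qed.

(** If every value M(u) were exceeded at some point up(u) of the square, then it would be
    exceeded on a neighbourhood of u by the same M(up(u)).  Finitely many such neighbourhoods cover
    the square, and the largest of the finitely many values M(up(u)) contradicts itself. *)
Lemma square_max (M : C -> R) (p : C) (r : R) : 0 <= r ->
  (forall z, @continuous C_UniformSpace R_UniformSpace M z) ->
  exists z0, forall z, Rabs (Re z - Re p) <= r -> Rabs (Im z - Im p) <= r -> M z <= M z0.
Proof.
  intros Hr Hc. apply NNPP. intros Hno.
  assert (Hup : forall u, exists v, (Rabs (Re v - Re p) <= r /\ Rabs (Im v - Im p) <= r) /\ M u < M v).
  { intros u. apply NNPP. intros H. apply Hno. exists u. intros z H1 H2.
    apply Rnot_lt_le. intros Hlt. apply H. now exists z. }
  pose (up := fun u => proj1_sig (constructive_indefinite_description _ (Hup u))).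
  assert (Pup : forall u, (Rabs (Re (up u) - Re p) <= r /\ Rabs (Im (up u) - Im p) <= r) /\ M u < M (up u))
    by (intros u; exact (proj2_sig (constructive_indefinite_description _ (Hup u)))).
  assert (Hd : forall u : C, exists d : posreal, forall w : C,
     Rabs (Re w - Re u) < d -> Rabs (Im w - Im u) < d -> M w < M (up u)).
  { intros u. assert (E : 0 < M (up u) - M u) by (generalize (proj2 (Pup u)); lra).
    destruct (proj1 (filterlim_locally (U := R_UniformSpace) _ _) (Hc u) (mkposreal _ E)) as [d Hd].
    exists d. intros w H1 H2. specialize (Hd w (conj H1 H2)).
    change (Rabs (M w - M u) < M (up u) - M u) in Hd. apply Rabs_def2 in Hd. lra. }
  pose (toC := fun x : Compactness.Tn 2 R => (fst x, fst (snd x)) : C).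
  pose (delta := fun x => proj1_sig (constructive_indefinite_description _ (Hd (toC x)))).
  assert (Pdelta : forall x (w : C), Rabs (Re w - Re (toC x)) < delta x ->
     Rabs (Im w - Im (toC x)) < delta x -> M w < M (up (toC x)))
    by (intros x; exact (proj2_sig (constructive_indefinite_description _ (Hd (toC x))))).
  (* The finite cover is obtained up to a double negation, which suffices here. *)
  apply (compactness_list 2 (Re p - r, (Im p - r, tt)) (Re p + r, (Im p + r, tt)) delta).
  intros [l Hl].
  assert (Cover : forall z : C, Rabs (Re z - Re p) <= r -> Rabs (Im z - Im p) <= r ->
     exists x, List.In x l /\ M z < M (up (toC x))).
  { intros z H1 H2. apply Rabs_le_between in H1. apply Rabs_le_between in H2.
    destruct (Hl (Re z, (Im z, tt))) as [[x1 [x2 []]] [Hin [_ [C1 [C2 _]]]]].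
    - simpl. repeat split; lra.
    - exists (x1, (x2, tt)). split; [exact Hin|]. now apply Pdelta. }
  assert (Best : forall l', (exists x, List.In x l') ->
     exists x, List.In x l' /\ forall y, List.In y l' -> M (up (toC y)) <= M (up (toC x))).
  { induction l' as [|a l' IH]; [intros [x []]|]. intros _.
    destruct l' as [|b l'].
    - exists a. split; [now left|]. intros y [->|[]]. lra.
    - destruct IH as [x [Hx Hm]]; [exists b; now left|].
      destruct (Rle_dec (M (up (toC x))) (M (up (toC a)))) as [H|H].
      + exists a. split; [now left|]. intros y [->|Hy]; [lra|]. specialize (Hm y Hy). lra.
      + exists x. split; [now right|]. intros y [->|Hy]; [lra|]. now apply Hm. }
  destruct (Cover p) as [x0 [Hx0 _]]; try (rewrite Rminus_diag Rabs_R0; exact Hr).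
  destruct (Best l (ex_intro _ x0 Hx0)) as [x [Hx Hm]].
  destruct (Pup (toC x)) as [[H1 H2] _].
  destruct (Cover _ H1 H2) as [y [Hy Hlt]]. specialize (Hm y Hy). lra.
Qed.

(** * A Schwarz lemma of Ahlfors type *)

Lemma second_deriv_ln_quad (A b : R) : 0 < A ->
  second_deriv (fun t => ln (A - 2 * b * t - t * t)) (- 2 * b / A) ((- 2 * A - 4 * (b * b)) / (A * A)).
Proof.
  intros HA. exists (fun t => (- 2 * b - 2 * t) / (A - 2 * b * t - t * t)).
  assert (Hb := Rabs_pos b).
  split; [|split].
  - set (d := Rmin 1 (A / (2 * Rabs b + 1))).
    assert (Hd : 0 < d) by (apply Rmin_pos; [lra|]; apply Rdiv_lt_0_compat; lra).
    exists (mkposreal d Hd). intros t Ht. change (Rabs (t - 0) < d) in Ht. rewrite Rminus_0_r in Ht.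
    assert (H1 := Rlt_le_trans _ _ _ Ht (Rmin_l _ _)).
    assert (H2 := Rlt_le_trans _ _ _ Ht (Rmin_r _ _)).
    apply (Rmult_lt_compat_r (2 * Rabs b + 1)) in H2; [|lra].
    replace (A / (2 * Rabs b + 1) * (2 * Rabs b + 1)) with A in H2 by (field; lra).
    assert (P : 0 < A - 2 * b * t - t * t).
    { assert (K1 : b * t <= Rabs b * Rabs t) by (rewrite -Rabs_mult; apply Rle_abs).
      assert (K2 : t * t <= Rabs t).
      { replace (t * t) with (Rabs t * Rabs t) by (rewrite -Rabs_mult; apply Rabs_pos_eq; nra).
        generalize (Rabs_pos t). nra. }
      nra. }
    auto_derive; [exact P|]. field. lra.
  - field. lra.
  - auto_derive; [lra|]. field. lra.
Qed.

Lemma continuous_pos_near {T : UniformSpace} (g : T -> R) (x : T) :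
  @continuous T R_UniformSpace g x -> 0 < g x -> locally x (fun y => 0 < g y).
Proof.
  intros Hg Hp.
  generalize (proj1 (filterlim_locally (U := R_UniformSpace) _ _) Hg (mkposreal _ Hp)).
  apply filter_imp. intros y Hy. change (Rabs (g y - g x) < g x) in Hy.
  apply Rabs_def2 in Hy. lra.
Qed.

(** Along a line the barrier is a quadratic polynomial, which [second_deriv_ln_quad]
    covers. *)
Lemma barrier_line (p z e : C) (r t : R) : Cmod e = 1 ->
  r ^ 2 - Cmod (z + t * e - p)%C ^ 2 =
  r ^ 2 - Cmod (z - p)%C ^ 2 - 2 * (Re (z - p)%C * Re e + Im (z - p)%C * Im e) * t - t * t.
Proof.
  intros He. assert (E := Cmod2_alt e). rewrite He in E. rewrite !Cmod2_alt.
  destruct z as [x y], p as [a b], e as [u v]. simpl in *.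
  replace (t * t) with (t * t * (u * (u * 1) + v * (v * 1))) by (rewrite -E; ring). ring.
Qed.

(** The function ln S + 3 ln D, where D(w) = r^2 - |w - p|^2, has a local maximum at z; its
    second derivative in the direction e is d2 plus three times the one of ln D. *)
Lemma second_deriv_at_max (S : C -> R) (p z e : C) (r d1 d2 : R) :
  (forall w, @continuous C_UniformSpace R_UniformSpace S w) ->
  0 < S z -> 0 < r ^ 2 - Cmod (z - p)%C ^ 2 -> Cmod e = 1 ->
  (forall w, S w * (r ^ 2 - Cmod (w - p)%C ^ 2) ^ 3 <= S z * (r ^ 2 - Cmod (z - p)%C ^ 2) ^ 3) ->
  second_deriv (fun t => ln (S (z + t * e)%C)) d1 d2 ->
  d2 <= 3 * ((2 * (r ^ 2 - Cmod (z - p)%C ^ 2) +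
    4 * (Re (z - p)%C * Re e + Im (z - p)%C * Im e) ^ 2) / (r ^ 2 - Cmod (z - p)%C ^ 2) ^ 2).
Proof.
  intros Hc HS HD He Hmax H2.
  set (A := r ^ 2 - Cmod (z - p)%C ^ 2) in *.
  set (b := Re (z - p)%C * Re e + Im (z - p)%C * Im e) in *.
  assert (Q := second_deriv_ln_quad A b HD).
  assert (T := second_deriv_plus _ _ _ _ _ _ H2 (second_deriv_plus _ _ _ _ _ _ Q (second_deriv_plus _ _ _ _ _ _ Q Q))).
  apply second_deriv_test in T.
  - replace (3 * ((2 * A + 4 * b ^ 2) / A ^ 2)) with (- (3 * ((- 2 * A - 4 * (b * b)) / (A * A))))
      by (field; lra). lra.
  - assert (Z : (z + 0 * e = z)%C) by ring.
    assert (L1 : locally 0 (fun t : R => 0 < S (z + t * e)%C)).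
    { apply (continuous_pos_near (T := R_UniformSpace) (fun t : R => S (z + t * e)%C)); [|now rewrite Z].
      apply (@continuous_comp R_UniformSpace C_UniformSpace R_UniformSpace (fun t : R => z + t * e)%C S);
        [apply Rcont_line|apply Hc]. }
    assert (L2 : locally 0 (fun t : R => 0 < A - 2 * b * t - t * t)).
    { apply (continuous_pos_near (T := R_UniformSpace) (fun t : R => A - 2 * b * t - t * t)); [|lra].
      apply (@ex_derive_continuous R_AbsRing R_NormedModule). auto_derive. trivial. }
    generalize (filter_and _ _ L1 L2). apply filter_imp. intros t [P1 P2].
    assert (P3 : 0 < A - 2 * b * 0 - 0 * 0) by lra.
    assert (M := Hmax (z + t * e)%C). rewrite (barrier_line p z e r t He) in M. fold A b in M.
    rewrite Z. set (q := A - 2 * b * t - t * t) in *.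
    replace (A - 2 * b * 0 - 0 * 0) with A by ring.
    rewrite -!ln_mult; try (repeat apply Rmult_lt_0_compat; assumption).
    apply ln_le; [repeat apply Rmult_lt_0_compat; assumption|].
    replace (q * (q * q)) with (q ^ 3) by ring. replace (A * (A * A)) with (A ^ 3) by ring. exact M.
Qed.

(** Let z0 maximise S D^3 with D = r^2 - |z - p|^2.  Adding the two second derivative
    tests gives X <= 12 r^2 / D^2 at z0, hence y D <= k r with k = 12 K + 1 and
    S D^3 <= (y D) D^2 + (y D)^2 D <= (k + k^2) r^5 for r >= 1.  Comparison with the value S(p) r^6
    at the centre bounds S(p) by (k + k^2) / r.  The third power of D is odd, so the product is
    at most 0 outside the disc and the maximum over the enclosing square is a global one; the power is also
    large enough to absorb both D^2 and D. *)
Lemma ahlfors_vanishing (S X : C -> R) (K : R) :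
  (forall z, 0 <= S z) -> (forall z, @continuous C_UniformSpace R_UniformSpace S z) -> 0 <= K ->
  (forall z, 0 < S z ->
     (exists y, 0 <= y /\ y * y <= K * X z /\ S z <= y + y * y) /\
     exists d1 d2 e1 e2, second_deriv (fun t => ln (S (z + t * 1)%C)) d1 d2 /\
       second_deriv (fun t => ln (S (z + t * Ci)%C)) e1 e2 /\ X z = d2 + e2) ->
  forall p, S p = 0.
Proof.
  intros HS0 Hc HK H p. apply Rle_antisym; [|apply HS0]. apply Rnot_lt_le. intros Hp.
  set (k := 12 * K + 1).
  (* The radius is chosen so that the bound (k + k^2) / r falls below S p. *)
  set (r := (k + k * k) / S p + 1).
  assert (Hk : 1 <= k) by (unfold k; lra).
  assert (Hr : 1 <= r).
  { unfold r. assert (0 <= (k + k * k) / S p); [|lra].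
    apply Rmult_le_pos; [nra|]. now apply Rlt_le, Rinv_0_lt_compat. }
  assert (HSr : k + k * k < S p * r).
  { unfold r. replace (S p * ((k + k * k) / S p + 1)) with (k + k * k + S p) by (field; lra). lra. }
  set (D := fun z => r ^ 2 - Cmod (z - p)%C ^ 2).
  assert (HDc : forall z, @continuous C_UniformSpace R_UniformSpace D z).
  { intros z. assert (C1 : @continuous C_UniformSpace R_UniformSpace (fun w => Cmod (w - p)%C) z).
    { apply ccont_Cmod. apply ccont_minus; [apply ccont_id|apply ccont_const]. }
    apply (@continuous_comp C_UniformSpace R_UniformSpace R_UniformSpace _ (fun x => r ^ 2 - x ^ 2)); [exact C1|].
    apply (@ex_derive_continuous R_AbsRing R_NormedModule). auto_derive. trivial. }
  destruct (square_max (fun z => S z * D z ^ 3) p r ltac:(lra)) as [z0 Hz0].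
  { intros z. apply (continuous_mult S); [apply Hc|].
    apply (@continuous_comp C_UniformSpace R_UniformSpace R_UniformSpace D (fun x => x ^ 3)); [apply HDc|].
    apply (@ex_derive_continuous R_AbsRing R_NormedModule). auto_derive. trivial. }
  assert (Dp : D p = r ^ 2).
  { unfold D. replace (p - p)%C with (RtoC 0) by ring. rewrite Cmod_0. ring. }
  assert (Mp : S p * (r ^ 2) ^ 3 <= S z0 * D z0 ^ 3).
  { rewrite -Dp. apply Hz0; rewrite Rminus_diag Rabs_R0; lra. }
  assert (Mpos : 0 < S p * (r ^ 2) ^ 3) by (apply Rmult_lt_0_compat; [exact Hp|]; repeat apply pow_lt; lra).
  assert (Hcube : forall x : R, x <= 0 -> x ^ 3 <= 0).
  { intros x Hx. replace (x ^ 3) with (- ((- x) ^ 3)) by ring.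
    assert (0 <= (- x) ^ 3) by (apply pow_le; lra). lra. }
  assert (D0 : 0 < D z0).
  { apply Rnot_le_lt. intros Hle. assert (Q := Hcube _ Hle). generalize (HS0 z0). nra. }
  assert (S0 : 0 < S z0).
  { destruct (HS0 z0) as [Q|Q]; [exact Q|]. rewrite -Q in Mp. lra. }
  assert (Hmax : forall w, S w * D w ^ 3 <= S z0 * D z0 ^ 3).
  { intros w. destruct (Rle_dec (Cmod (w - p)%C) r) as [Hw|Hw].
    - apply Hz0; (eapply Rle_trans; [|exact Hw]).
      + apply (re_le_Cmod (w - p)%C).
      + apply (im_le_Cmod (w - p)%C).
    - assert (Q : D w ^ 3 <= 0) by (apply Hcube; unfold D; nra).
      generalize (HS0 w). nra. }
  destruct (H z0 S0) as [[y [Hy0 [Hy1 Hy2]]] [d1 [d2 [e1 [e2 [Hd [He HX]]]]]]].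
  assert (B1 := second_deriv_at_max S p z0 1 r d1 d2 Hc S0 D0 Cmod_1 Hmax Hd).
  assert (B2 := second_deriv_at_max S p z0 Ci r e1 e2 Hc S0 D0 Cmod_Ci Hmax He).
  fold (D z0) in B1, B2. simpl Re in B1, B2. simpl Im in B1, B2.
  assert (HXb : X z0 <= 12 * (r * r) / (D z0 ^ 2)).
  { rewrite HX. eapply Rle_trans; [apply Rplus_le_compat; [exact B1|exact B2]|].
    assert (E : D z0 = r ^ 2 - ((Re z0 + - Re p) ^ 2 + (Im z0 + - Im p) ^ 2)).
    { unfold D. rewrite Cmod2_alt. reflexivity. }
    right. unfold Re, Im in *. set (q := D z0) in *.
    replace (12 * (r * r)) with (12 * (q + ((fst z0 + - fst p) ^ 2 + (snd z0 + - snd p) ^ 2)))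
      by (rewrite E; ring).
    field. lra. }
  set (q := D z0) in *.
  assert (Hqr : q <= r ^ 2) by (unfold q, D; generalize (pow2_ge_0 (Cmod (z0 - p)%C)); lra).
  assert (Hyq : y * q <= k * r).
  { apply Rsqr_incr_0; [|nra|nra]. unfold Rsqr.
    assert (y * y * (q * q) <= K * (12 * (r * r))).
    { apply Rle_trans with (K * (12 * (r * r) / q ^ 2) * (q * q)).
      - apply Rmult_le_compat_r; [nra|]. eapply Rle_trans; [exact Hy1|]. now apply Rmult_le_compat_l.
      - right. field. lra. }
    assert (12 * K * (r * r) <= k * k * (r * r)); [|nra].
    apply Rmult_le_compat_r; [nra|]. unfold k. nra. }
  assert (Hfin : S z0 * q ^ 3 <= (k + k * k) * r ^ 5).
  { apply Rle_trans with ((y + y * y) * q ^ 3).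
    - apply Rmult_le_compat_r; [apply pow_le; lra|exact Hy2].
    - replace ((y + y * y) * q ^ 3) with (((y * q) * q + (y * q) * (y * q)) * q) by ring.
      assert (Y0 : 0 <= y * q) by nra.
      assert (I1 : y * q * q <= k * r * r ^ 2) by (apply Rmult_le_compat; lra).
      assert (I2 : (y * q) * (y * q) <= (k * r) * (k * r)) by (apply Rmult_le_compat; lra).
      assert (I3 : (k * r) * (k * r) <= k * k * r * r ^ 2).
      { replace (k * r * (k * r)) with (k * k * (r * r) * 1) by ring.
        replace (k * k * r * r ^ 2) with (k * k * (r * r) * r) by ring.
        apply Rmult_le_compat_l; [nra|exact Hr]. }
      replace ((k + k * k) * r ^ 5) with ((k * r * r ^ 2 + k * k * r * r ^ 2) * r ^ 2) by ring.
      apply Rmult_le_compat; [nra|lra|lra|exact Hqr]. }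
  assert (Hr5 : 0 < r ^ 5) by (apply pow_lt; lra).
  replace (S p * (r ^ 2) ^ 3) with (S p * r * r ^ 5) in Mp by ring.
  assert ((k + k * k) * r ^ 5 < S p * r * r ^ 5) by (now apply Rmult_lt_compat_r). lra.
Qed.

(** * The weight *)

(** For r = |w - a| and v = ln r, exp (chi v) = r^(-7/8) (1 + r^(1/8)) is the factor of
    H / |P| that belongs to a.  Only the convex second summand contributes to the Laplacian of
    chi (ln |f - a|). *)
Definition chi (v : R) : R := - (7 / 8) * v + ln (1 + exp (v / 8)).
Definition chi1 (v : R) : R := - (7 / 8) + / 8 * (exp (v / 8) / (1 + exp (v / 8))).
Definition chi2 (v : R) : R := / 64 * (exp (v / 8) / (1 + exp (v / 8)) ^ 2).

Lemma chi_deriv (v : R) : is_derive chi v (chi1 v).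
Proof.
  unfold chi, chi1. assert (P := exp_pos (v / 8)).
  auto_derive; unfold Rdiv in *; [lra|]. field. lra.
Qed.

Lemma chi1_deriv (v : R) : is_derive chi1 v (chi2 v).
Proof.
  unfold chi1, chi2. assert (P := exp_pos (v / 8)).
  auto_derive; unfold Rdiv in *; [lra|]. field. lra.
Qed.

Lemma chi2_pos (v : R) : 0 < chi2 v.
Proof.
  unfold chi2. assert (P := exp_pos (v / 8)).
  apply Rmult_lt_0_compat; [lra|]. apply Rdiv_lt_0_compat; [exact P|]. apply pow_lt. lra.
Qed.

(** The value 0 at r = 0 is forced by continuity of the final density rather than of the
    weight itself, which tends to infinity there. *)
Definition weight (r : R) : R :=
  match Req_dec_T r 0 with left _ => 0 | right _ => exp (chi (ln r)) end.

Definition root8 (r : R) : R := exp (ln r / 8).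

Lemma root8_pos r : 0 < root8 r.
Proof. apply exp_pos. Qed.

Lemma root8_pow r : 0 < r -> root8 r ^ 8 = r.
Proof.
  intros Hr. unfold root8. rewrite -{2}(exp_ln r Hr).
  replace (ln r) with (ln r / 8 * 8) at 2 by field.
  set (u := ln r / 8). simpl.
  replace (u * 8) with (u + (u + (u + (u + (u + (u + (u + (u + 0)))))))) by ring.
  rewrite !exp_plus exp_0. ring.
Qed.

Lemma root8_le r s : 0 < r -> r <= s -> root8 r <= root8 s.
Proof.
  intros Hr Hrs. unfold root8. destruct (Req_dec r s) as [->|Hn]; [lra|].
  apply Rlt_le, exp_increasing. assert (ln r < ln s) by (apply ln_increasing; lra). lra.
Qed.

Lemma weight_0 : weight 0 = 0.
Proof. unfold weight. now destruct (Req_dec_T 0 0). Qed.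

Lemma weight_exp r : r <> 0 -> weight r = exp (chi (ln r)).
Proof. intros H. unfold weight. now destruct (Req_dec_T r 0). Qed.

Lemma weight_ge0 r : 0 <= weight r.
Proof. unfold weight. destruct (Req_dec_T r 0); [lra|apply Rlt_le, exp_pos]. Qed.

Lemma weight_root8 r : 0 < r -> weight r = (1 + root8 r) / root8 r ^ 7.
Proof.
  intros Hr. rewrite weight_exp; [|lra]. unfold chi. rewrite exp_plus exp_ln.
  2:{ generalize (exp_pos (ln r / 8)). lra. }
  fold (root8 r). assert (P := root8_pos r).
  replace (exp (- (7 / 8) * ln r)) with (/ (root8 r ^ 7)).
  - field. lra.
  - unfold root8. set (u := ln r / 8).
    replace (- (7 / 8) * ln r) with (- (u + (u + (u + (u + (u + (u + (u + 0)))))))) by (unfold u; field).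
    rewrite exp_Ropp. f_equal. rewrite !exp_plus exp_0. simpl. ring.
Qed.

Lemma chi2_root8 r : 0 < r ->
  chi2 (ln r) / r ^ 2 = / (64 * (1 + root8 r) ^ 2 * root8 r ^ 15).
Proof.
  intros Hr. rewrite -{2}(root8_pow r Hr). unfold chi2. fold (root8 r).
  assert (P := root8_pos r). field. lra.
Qed.

Lemma weight_cont (r : R) : 0 < r -> continuous weight r.
Proof.
  intros Hr. apply (continuous_ext_loc _ (fun s => exp (chi (ln s)))).
  - exists (mkposreal r Hr). intros s Hs. change (Rabs (s - r) < r) in Hs.
    apply Rabs_def2 in Hs. symmetry. apply weight_exp. lra.
  - apply (@ex_derive_continuous R_AbsRing R_NormedModule). unfold chi.
    auto_derive. assert (P := exp_pos (ln r * / 8)). unfold Rdiv in *. repeat split; lra.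
Qed.

(** With x = r^(1/8) the product is x (1 + x). *)
Lemma weight_small (eps : R) : 0 < eps -> exists d, 0 < d /\
  forall r, 0 <= r < d -> r * weight r < eps.
Proof.
  intros He. set (e := Rmin 1 (eps / 2)).
  assert (P : 0 < e) by (apply Rmin_pos; lra).
  assert (E1 : e <= 1) by apply Rmin_l. assert (E2 : e <= eps / 2) by apply Rmin_r.
  exists (e ^ 8). split; [now apply pow_lt|]. intros r [H1 H2].
  destruct H1 as [H1|<-]; [|rewrite Rmult_0_l; exact He].
  rewrite weight_root8 //. rewrite -{1}(root8_pow r H1).
  rewrite -(root8_pow r H1) in H2. assert (Q := root8_pos r). set (x := root8 r) in *.
  replace (x ^ 8 * ((1 + x) / x ^ 7)) with (x * (1 + x)) by (field; lra).
  assert (Hx : x < e).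
  { apply Rnot_le_lt. intros Hle. assert (K := pow_incr e x 8 (conj (Rlt_le _ _ P) Hle)). lra. }
  nra.
Qed.

Lemma weight_far (b m x : R) : 0 < b -> b <= m -> m <= x ->
  (1 + x) / x ^ 7 <= (1 + / b) / m ^ 6.
Proof.
  intros Hb Hm Hx.
  assert (Ib : 0 < / b) by now apply Rinv_0_lt_compat.
  apply Rle_trans with ((1 + / b) * / x ^ 6).
  - apply (Rmult_le_reg_r (x ^ 7)); [apply pow_lt; lra|].
    replace ((1 + x) / x ^ 7 * x ^ 7) with (1 + x) by (field; lra).
    replace ((1 + / b) * / x ^ 6 * x ^ 7) with (x + / b * x) by (field; lra).
    assert (1 <= / b * x); [|lra]. apply (Rmult_le_reg_l b); [exact Hb|].
    rewrite -Rmult_assoc Rinv_r; lra.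
  - apply Rmult_le_compat_l; [lra|]. apply Rinv_le_contravar; [apply pow_lt; lra|].
    apply pow_incr. lra.
Qed.

(** Here x, y, z are the eighth roots of the distances of w to the three values and x
    is the smallest, so that L is at least the term 1 / (64 (1 + x)^2 x^15) of the nearest value.
    With m = max(x, b) and B = 1 + 1/b, the two other factors are at most B / m^6, and 1 + x <= B m.
    Both inequalities then compare powers of m >= b: 64 B^5 m^11 against m^12 and
    64 (1 + E)^2 B^8 m^5 against m^8. *)
Lemma weights_bound (b E x y z W : R) : 0 < b -> 0 < x -> x <= y -> x <= z -> b <= y -> b <= z ->
  0 <= W -> W <= x ^ 8 + E * b ^ 8 -> 0 <= E ->
  let G := (1 + x) / x ^ 7 * ((1 + y) / y ^ 7) * ((1 + z) / z ^ 7) in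
  let K := 64 * (1 + / b) ^ 6 + 64 * (1 + E) ^ 2 * (1 + / b) ^ 11 in
  G <= K * / (64 * (1 + x) ^ 2 * x ^ 15) /\ (W * G) ^ 2 <= K * / (64 * (1 + x) ^ 2 * x ^ 15).
Proof.
  intros Hb Hx Hxy Hxz Hby Hbz HW0 HW HE G K.
  assert (Ib : 0 < / b) by now apply Rinv_0_lt_compat.
  set (B := 1 + / b) in *.
  set (m := Rmax x b).
  assert (Mx : x <= m) by apply Rmax_l. assert (Mb : b <= m) by apply Rmax_r.
  assert (My : m <= y) by now apply Rmax_lub. assert (Mz : m <= z) by now apply Rmax_lub.
  assert (Gy := weight_far b m y Hb Mb My). assert (Gz := weight_far b m z Hb Mb Mz). fold B in Gy, Gz.
  assert (B1 : 1 <= B) by (unfold B; lra).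
  assert (m0 : 0 < m) by lra.
  assert (Bm : 1 <= B * m).
  { unfold B. assert (1 <= / b * m); [|nra]. apply (Rmult_le_reg_l b); [exact Hb|].
    rewrite -Rmult_assoc Rinv_r; lra. }
  assert (X1 : 1 + x <= B * m).
  { unfold B. assert (1 <= / b * m); [|lra]. apply (Rmult_le_reg_l b); [exact Hb|].
    rewrite -Rmult_assoc Rinv_r; lra. }
  assert (HG : G <= (1 + x) / x ^ 7 * (B ^ 2 / m ^ 12)).
  { unfold G. replace (B ^ 2 / m ^ 12) with (B / m ^ 6 * (B / m ^ 6)) by (field; lra).
    rewrite Rmult_assoc. apply Rmult_le_compat_l.
    - apply Rlt_le, Rdiv_lt_0_compat; [lra|now apply pow_lt].
    - apply Rmult_le_compat; try assumption; apply Rlt_le, Rdiv_lt_0_compat; try lra; apply pow_lt; lra. }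
  assert (HG0 : 0 <= G).
  { unfold G. repeat apply Rmult_le_pos; try lra; apply Rlt_le, Rinv_0_lt_compat, pow_lt; lra. }
  assert (HB : forall n, 0 < B ^ n) by (intros; apply pow_lt; lra).
  assert (Hm : forall n, 0 < m ^ n) by (intros; now apply pow_lt).
  assert (Hxn : forall n, 0 < x ^ n) by (intros; now apply pow_lt).
  assert (Hx1 : forall n, 0 < (1 + x) ^ n) by (intros; apply pow_lt; lra).
  assert (HE2 : 0 < (1 + E) ^ 2) by (apply pow_lt; lra).
  set (L := / (64 * (1 + x) ^ 2 * x ^ 15)).
  assert (HL : 0 < L).
  { apply Rinv_0_lt_compat. apply Rmult_lt_0_compat; [|apply Hxn]. apply Rmult_lt_0_compat; [lra|apply Hx1]. }
  assert (P1 : forall n, (1 + x) ^ n <= (B * m) ^ n) by (intros n; apply pow_incr; lra).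
  assert (P2 : forall n, x ^ n <= m ^ n) by (intros n; apply pow_incr; lra).
  split.
  - apply Rle_trans with (64 * B ^ 6 * L).
    2:{ apply Rmult_le_compat_r; [lra|]. unfold K.
        assert (0 <= 64 * (1 + E) ^ 2 * B ^ 11); [|lra].
        apply Rmult_le_pos; [lra|apply Rlt_le, HB]. }
    eapply Rle_trans; [exact HG|].
    replace ((1 + x) / x ^ 7 * (B ^ 2 / m ^ 12)) with
      (64 * (1 + x) ^ 3 * x ^ 8 * B ^ 2 / m ^ 12 * L) by (unfold L; field; lra).
    apply Rmult_le_compat_r; [lra|].
    apply (Rmult_le_reg_r (m ^ 12)); [apply Hm|].
    replace (64 * (1 + x) ^ 3 * x ^ 8 * B ^ 2 / m ^ 12 * m ^ 12) with
      (64 * B ^ 2 * ((1 + x) ^ 3 * x ^ 8)) by (field; lra).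
    apply Rle_trans with (64 * B ^ 2 * ((B * m) ^ 3 * m ^ 8)).
    + apply Rmult_le_compat_l; [generalize (HB 2%nat); lra|].
      apply Rmult_le_compat; [apply Rlt_le, Hx1|apply Rlt_le, Hxn|apply P1|apply P2].
    + replace (64 * B ^ 2 * ((B * m) ^ 3 * m ^ 8)) with (64 * B ^ 5 * m ^ 11 * 1) by ring.
      replace (64 * B ^ 6 * m ^ 12) with (64 * B ^ 5 * m ^ 11 * (B * m)) by ring.
      apply Rmult_le_compat_l; [|exact Bm].
      apply Rmult_le_pos; [generalize (HB 5%nat); lra|apply Rlt_le, Hm].
  - apply Rle_trans with (64 * (1 + E) ^ 2 * B ^ 11 * L).
    2:{ apply Rmult_le_compat_r; [lra|]. unfold K. generalize (HB 6%nat). lra. }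
    assert (WE : W <= (1 + E) * m ^ 8).
    { assert (Q8 : b ^ 8 <= m ^ 8) by (apply pow_incr; lra). generalize (P2 8%nat). nra. }
    apply Rle_trans with (((1 + E) * m ^ 8 * ((1 + x) / x ^ 7 * (B ^ 2 / m ^ 12))) ^ 2).
    { apply pow_incr. split; [now apply Rmult_le_pos|]. now apply Rmult_le_compat. }
    replace (((1 + E) * m ^ 8 * ((1 + x) / x ^ 7 * (B ^ 2 / m ^ 12))) ^ 2) with
      (64 * (1 + E) ^ 2 * B ^ 4 * ((1 + x) ^ 4 * x ^ 1) / m ^ 8 * L) by (unfold L; field; lra).
    apply Rmult_le_compat_r; [lra|].
    apply (Rmult_le_reg_r (m ^ 8)); [apply Hm|].
    replace (64 * (1 + E) ^ 2 * B ^ 4 * ((1 + x) ^ 4 * x ^ 1) / m ^ 8 * m ^ 8) with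
      (64 * (1 + E) ^ 2 * B ^ 4 * ((1 + x) ^ 4 * x ^ 1)) by (field; lra).
    apply Rle_trans with (64 * (1 + E) ^ 2 * B ^ 4 * ((B * m) ^ 4 * m ^ 1)).
    + apply Rmult_le_compat_l; [apply Rmult_le_pos; [lra|apply Rlt_le, HB]|].
      apply Rmult_le_compat; [apply Rlt_le, Hx1|apply Rlt_le, Hxn|apply P1|apply P2].
    + replace (64 * (1 + E) ^ 2 * B ^ 4 * ((B * m) ^ 4 * m ^ 1)) with
        (64 * (1 + E) ^ 2 * B ^ 8 * m ^ 5 * 1) by ring.
      replace (64 * (1 + E) ^ 2 * B ^ 11 * m ^ 8) with
        (64 * (1 + E) ^ 2 * B ^ 8 * m ^ 5 * (B * m) ^ 3) by ring.
      apply Rmult_le_compat_l.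
      * apply Rmult_le_pos; [apply Rmult_le_pos; [lra|apply Rlt_le, HB]|apply Rlt_le, Hm].
      * apply (pow_R1_Rle _ 3 Bm).
Qed.

(** The nearest of the three values plays the role of x in [weights_bound]; the other
    two are at distance at least d, half of the least distance between the values. *)
Lemma weights_bound_values (a1 a2 a3 : C) : a1 <> a2 -> a1 <> a3 -> a2 <> a3 ->
  exists K, 0 <= K /\ forall w : C, w <> a1 -> w <> a2 -> w <> a3 ->
  let r1 := Cmod (w - a1)%C in let r2 := Cmod (w - a2)%C in let r3 := Cmod (w - a3)%C in
  let G := weight r1 * weight r2 * weight r3 in
  let L := chi2 (ln r1) / r1 ^ 2 + chi2 (ln r2) / r2 ^ 2 + chi2 (ln r3) / r3 ^ 2 in
  G <= K * L /\ (Cmod w * G) ^ 2 <= K * L.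
Proof.
  intros H12 H13 H23.
  assert (d12 := proj1 (Cmod_gt_0 _) (Cminus_eq_contra _ _ H12)).
  assert (d13 := proj1 (Cmod_gt_0 _) (Cminus_eq_contra _ _ H13)).
  assert (d23 := proj1 (Cmod_gt_0 _) (Cminus_eq_contra _ _ H23)).
  set (d := Rmin (Cmod (a1 - a2)%C) (Rmin (Cmod (a1 - a3)%C) (Cmod (a2 - a3)%C)) / 2).
  assert (Hd : 0 < d) by (unfold d; assert (0 < Rmin (Cmod (a1 - a2)%C) (Rmin (Cmod (a1 - a3)%C) (Cmod (a2 - a3)%C)))
    by (repeat apply Rmin_pos; assumption); lra).
  assert (D12 : 2 * d <= Cmod (a1 - a2)%C).
  { unfold d. generalize (Rmin_l (Cmod (a1 - a2)%C) (Rmin (Cmod (a1 - a3)%C) (Cmod (a2 - a3)%C))). lra. }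
  assert (D0 := Rmin_r (Cmod (a1 - a2)%C) (Rmin (Cmod (a1 - a3)%C) (Cmod (a2 - a3)%C))).
  assert (D13 : 2 * d <= Cmod (a1 - a3)%C).
  { unfold d. generalize (Rmin_l (Cmod (a1 - a3)%C) (Cmod (a2 - a3)%C)). lra. }
  assert (D23 : 2 * d <= Cmod (a2 - a3)%C).
  { unfold d. generalize (Rmin_r (Cmod (a1 - a3)%C) (Cmod (a2 - a3)%C)). lra. }
  clear D0 d12 d13 d23. clearbody d.
  set (A := Cmod a1 + Cmod a2 + Cmod a3).
  assert (A1 := Cmod_ge_0 a1). assert (A2 := Cmod_ge_0 a2). assert (A3 := Cmod_ge_0 a3).
  set (b := root8 d). assert (Hb : 0 < b) by apply root8_pos.
  set (E := A / d). assert (HE : 0 <= E) by (apply Rmult_le_pos; [unfold A; lra|]; now apply Rlt_le, Rinv_0_lt_compat).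
  assert (Eb : E * b ^ 8 = A) by (unfold b, E; rewrite root8_pow //; field; lra).
  set (K := 64 * (1 + / b) ^ 6 + 64 * (1 + E) ^ 2 * (1 + / b) ^ 11).
  assert (Ib : 0 < / b) by now apply Rinv_0_lt_compat.
  assert (HK : 0 <= K).
  { unfold K. assert (0 < (1 + / b) ^ 6) by (apply pow_lt; lra).
    assert (0 < (1 + E) ^ 2 * (1 + / b) ^ 11) by (apply Rmult_lt_0_compat; apply pow_lt; lra). lra. }
  exists K. split; [exact HK|].
  assert (core : forall (w a a' a'' : C), w <> a -> w <> a' -> w <> a'' ->
    2 * d <= Cmod (a - a')%C -> 2 * d <= Cmod (a - a'')%C -> Cmod a <= A ->
    Cmod (w - a)%C <= Cmod (w - a')%C -> Cmod (w - a)%C <= Cmod (w - a'')%C ->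
    let G := weight (Cmod (w - a)%C) * weight (Cmod (w - a')%C) * weight (Cmod (w - a'')%C) in
    let L := chi2 (ln (Cmod (w - a)%C)) / Cmod (w - a)%C ^ 2 in
    G <= K * L /\ (Cmod w * G) ^ 2 <= K * L).
  { intros w a a' a'' N N' N'' Da Da' HA Hr Hr' G L.
    assert (R0 := proj1 (Cmod_gt_0 _) (Cminus_eq_contra _ _ N)).
    assert (R1 := proj1 (Cmod_gt_0 _) (Cminus_eq_contra _ _ N')).
    assert (R2 := proj1 (Cmod_gt_0 _) (Cminus_eq_contra _ _ N'')).
    assert (F1 : d <= Cmod (w - a')%C).
    { assert (T := Cmod_triangle (w - a')%C (a - w)%C).
      replace (w - a' + (a - w))%C with (a - a')%C in T by ring.
      rewrite (Cmod_minus_sym a w) in T. lra. }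
    assert (F2 : d <= Cmod (w - a'')%C).
    { assert (T := Cmod_triangle (w - a'')%C (a - w)%C).
      replace (w - a'' + (a - w))%C with (a - a'')%C in T by ring.
      rewrite (Cmod_minus_sym a w) in T. lra. }
    assert (FW : Cmod w <= Cmod (w - a)%C + A).
    { assert (T := Cmod_triangle (w - a)%C a). replace (w - a + a)%C with w in T by ring. lra. }
    unfold G, L. rewrite chi2_root8 // !weight_root8 //.
    apply (weights_bound b E); try assumption; try (now apply root8_le); try apply root8_pos.
    - apply Cmod_ge_0.
    - rewrite root8_pow // Eb. exact FW. }
  intros w N1 N2 N3 r1 r2 r3 G L.
  assert (R1 := proj1 (Cmod_gt_0 _) (Cminus_eq_contra _ _ N1)).
  assert (R2 := proj1 (Cmod_gt_0 _) (Cminus_eq_contra _ _ N2)).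
  assert (R3 := proj1 (Cmod_gt_0 _) (Cminus_eq_contra _ _ N3)).
  fold r1 in R1. fold r2 in R2. fold r3 in R3.
  assert (L1 : 0 < chi2 (ln r1) / r1 ^ 2) by (apply Rdiv_lt_0_compat; [apply chi2_pos|now apply pow_lt]).
  assert (L2 : 0 < chi2 (ln r2) / r2 ^ 2) by (apply Rdiv_lt_0_compat; [apply chi2_pos|now apply pow_lt]).
  assert (L3 : 0 < chi2 (ln r3) / r3 ^ 2) by (apply Rdiv_lt_0_compat; [apply chi2_pos|now apply pow_lt]).
  assert (fin : forall l, l <= L -> G <= K * l /\ (Cmod w * G) ^ 2 <= K * l ->
     G <= K * L /\ (Cmod w * G) ^ 2 <= K * L).
  { intros l Hl [Q1 Q2]. assert (K * l <= K * L) by now apply Rmult_le_compat_l. lra. }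
  assert (S12 := Cmod_minus_sym a1 a2). assert (S13 := Cmod_minus_sym a1 a3).
  assert (S23 := Cmod_minus_sym a2 a3).
  assert (cases : (r1 <= r2 /\ r1 <= r3) \/ (r2 <= r1 /\ r2 <= r3) \/ (r3 <= r1 /\ r3 <= r2)) by lra.
  destruct cases as [[Q1 Q2]|[[Q1 Q2]|[Q1 Q2]]].
  - apply (fin (chi2 (ln r1) / r1 ^ 2)); [unfold L; lra|].
    apply (core w a1 a2 a3); try assumption; unfold A; lra.
  - apply (fin (chi2 (ln r2) / r2 ^ 2)); [unfold L; lra|].
    replace G with (weight r2 * weight r1 * weight r3) by (unfold G; ring).
    apply (core w a2 a1 a3); try assumption; unfold A; lra.
  - apply (fin (chi2 (ln r3) / r3 ^ 2)); [unfold L; lra|].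
    replace G with (weight r3 * weight r1 * weight r2) by (unfold G; ring).
    apply (core w a3 a1 a2); try assumption; unfold A; lra.
Qed.

(** * The density of an entire function that shares three values *)

Definition density (f f1 : C -> C) (a b c : C) (z : C) : R :=
  Cmod (f1 z) * Cmod (f z - f1 z)%C *
  (weight (Cmod (f z - a)%C) * weight (Cmod (f z - b)%C) * weight (Cmod (f z - c)%C)).

Lemma density_ge0 f f1 a b c z : 0 <= density f f1 a b c z.
Proof.
  unfold density. repeat apply Rmult_le_pos; try apply Cmod_ge_0; apply weight_ge0.
Qed.

Lemma density_swap f f1 a b c z : density f f1 b a c z = density f f1 a b c z.
Proof. unfold density. ring. Qed.

Lemma density_rot f f1 a b c z : density f f1 c a b z = density f f1 a b c z.
Proof. unfold density. ring. Qed.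

Lemma Cmod_shift_cont (f : C -> C) (a z : C) : cont f ->
  @continuous C_UniformSpace R_UniformSpace (fun w => Cmod (f w - a)%C) z.
Proof. intros Hf. apply ccont_Cmod. apply ccont_minus; [apply Hf|apply ccont_const]. Qed.

Lemma weight_comp_cont (f : C -> C) (a z : C) : cont f -> f z <> a ->
  @continuous C_UniformSpace R_UniformSpace (fun w => weight (Cmod (f w - a)%C)) z.
Proof.
  intros Hf Hn. apply (@continuous_comp C_UniformSpace R_UniformSpace R_UniformSpace
    (fun w => Cmod (f w - a)%C) weight); [now apply Cmod_shift_cont|].
  apply weight_cont. apply Cmod_gt_0. now apply Cminus_eq_contra.
Qed.

(** At a shared point both f - a and f - f1 vanish.  So |f - f1| is O(|w - z|), and
    |f1| |w - z| is O(|f - a|) by [log_deriv_bound]. *)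
Lemma shared_point_bound (f f1 : C -> C) (a z : C) : (forall w, cderiv f w (f1 w)) ->
  (exists w, f w <> a) -> f z = a -> f1 z = a ->
  exists d K, 0 < d /\ 0 <= K /\ forall w, Cmod (w - z)%C < d ->
    Cmod (f1 w) * Cmod (f w - f1 w)%C <= K * Cmod (f w - a)%C.
Proof.
  intros Hf [w0 Hw0] Hz Hz1.
  assert (Hg : forall w, cderiv (fun u => f u - a)%C w (f1 w)).
  { intros w. eapply cderiv_eq; [apply cderiv_minus; [apply Hf|apply cderiv_const]|ring]. }
  destruct (log_deriv_bound _ f1 z Hg) as [d1 [K1 [Hd1 [HK1 B1]]]].
  { exists w0. now apply Cminus_eq_contra. }
  destruct (entire_deriv f f1 Hf z) as [l Hl].
  assert (Hh : cderiv (fun w => f w - f1 w)%C z (f1 z - l)%C) by (apply cderiv_minus; [apply Hf|exact Hl]).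
  destruct (proj1 (cderiv_eps _ _ _) Hh 1 Rlt_0_1) as [d2 [Hd2 B2]].
  set (K2 := 1 + Cmod (f1 z - l)%C). assert (P2 := Cmod_ge_0 (f1 z - l)%C).
  exists (Rmin d1 d2), (K1 * K2). split; [now apply Rmin_pos|].
  split; [apply Rmult_le_pos; [exact HK1|unfold K2; lra]|]. intros w Hw.
  specialize (B1 w (Rlt_le_trans _ _ _ Hw (Rmin_l _ _))). simpl in B1.
  specialize (B2 w (Rlt_le_trans _ _ _ Hw (Rmin_r _ _))). simpl in B2.
  assert (B3 : Cmod (f w - f1 w)%C <= K2 * Cmod (w - z)%C).
  { rewrite Hz Hz1 in B2.
    replace (f w - f1 w)%C with ((f w - f1 w - (a - a) - (w - z) * (a - l)) + (w - z) * (a - l))%C by ring.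
    eapply Rle_trans; [apply Cmod_triangle|]. rewrite Cmod_mult. unfold K2. rewrite Hz1. lra. }
  apply Rle_trans with (Cmod (f1 w) * (K2 * Cmod (w - z)%C)).
  - apply Rmult_le_compat_l; [apply Cmod_ge_0|exact B3].
  - replace (Cmod (f1 w) * (K2 * Cmod (w - z)%C)) with (K2 * (Cmod (w - z)%C * Cmod (f1 w))) by ring.
    replace (K1 * K2 * Cmod (f w - a)%C) with (K2 * (K1 * Cmod (f w - a)%C)) by ring.
    apply Rmult_le_compat_l; [unfold K2; lra|exact B1].
Qed.

(** Writing r = |f - a|, the density is at most a constant times r [weight] r near z, by
    [shared_point_bound], and this tends to 0 with r. *)
Lemma density_cont_at_value (f f1 : C -> C) (a b c z : C) : (forall w, cderiv f w (f1 w)) ->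
  (exists w, f w <> a) -> a <> b -> a <> c -> f z = a -> f1 z = a ->
  @continuous C_UniformSpace R_UniformSpace (density f f1 a b c) z.
Proof.
  intros Hf Hnc Hab Hac Hz Hz1.
  assert (Hc : cont f) by (apply ex_deriv_cont; intros w; exists (f1 w); apply Hf).
  destruct (shared_point_bound f f1 a z Hf Hnc Hz Hz1) as [d [K [Hd [HK B]]]].
  set (h := fun w => weight (Cmod (f w - b)%C) * weight (Cmod (f w - c)%C)).
  assert (h0 : forall w, 0 <= h w) by (intros; apply Rmult_le_pos; apply weight_ge0).
  assert (Hh : @continuous C_UniformSpace R_UniformSpace h z).
  { apply (continuous_mult (fun w => weight (Cmod (f w - b)%C)));
      apply weight_comp_cont; try exact Hc; rewrite Hz; assumption. }
  assert (Z : density f f1 a b c z = 0).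
  { unfold density. replace (f z - a)%C with (RtoC 0) by (rewrite Hz; ring).
    rewrite Cmod_0 weight_0. ring. }
  apply (filterlim_locally (U := R_UniformSpace)). intros eps. rewrite Z.
  set (T := (K + 1) * (h z + 1)). assert (HT : 0 < T) by (unfold T; generalize (h0 z); nra).
  destruct (weight_small (eps / T)) as [e [He W]]; [apply Rdiv_lt_0_compat; [apply cond_pos|exact HT]|].
  assert (L1 := proj1 (filterlim_locally (U := R_UniformSpace) _ _) Hh (mkposreal 1 Rlt_0_1)).
  assert (L2 := proj1 (filterlim_locally (U := R_UniformSpace) _ _) (Cmod_shift_cont f a z Hc) (mkposreal e He)).
  assert (L3 : @locally C_UniformSpace z (fun w => Cmod (w - z)%C < d)) by (now apply (locally_C_ball z _ d)).
  generalize (filter_and _ _ L1 (filter_and _ _ L2 L3)). apply filter_imp.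
  intros w [E1 [E2 E3]]. change (Rabs (h w - h z) < 1) in E1.
  change (Rabs (Cmod (f w - a)%C - Cmod (f z - a)%C) < e) in E2.
  replace (f z - a)%C with (RtoC 0) in E2 by (rewrite Hz; ring). rewrite Cmod_0 Rminus_0_r in E2.
  apply Rabs_def2 in E1. apply Rabs_def2 in E2. specialize (B w E3).
  change (Rabs (density f f1 a b c w - 0) < eps). rewrite Rminus_0_r.
  rewrite Rabs_pos_eq; [|apply density_ge0].
  assert (Hr := Cmod_ge_0 (f w - a)%C). set (r := Cmod (f w - a)%C) in *.
  specialize (W r ltac:(lra)).
  assert (wr := weight_ge0 r).
  apply Rle_lt_trans with ((K * r) * (weight r * h w)).
  - replace (density f f1 a b c w) with (Cmod (f1 w) * Cmod (f w - f1 w)%C * (weight r * h w))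
      by (unfold density, h, r; ring).
    apply Rmult_le_compat_r; [now apply Rmult_le_pos|exact B].
  - assert (q0 : 0 <= r * weight r) by now apply Rmult_le_pos.
    apply Rle_lt_trans with (T * (r * weight r)).
    + replace (K * r * (weight r * h w)) with ((K * h w) * (r * weight r)) by ring.
      apply Rmult_le_compat_r; [exact q0|]. unfold T. apply Rmult_le_compat; try lra. apply h0.
    + apply (Rmult_lt_compat_l T) in W; [|exact HT].
      replace (T * (eps / T)) with (pos eps) in W by (field; lra). exact W.
Qed.

Lemma density_cont (f f1 : C -> C) (a b c z : C) : (forall w, cderiv f w (f1 w)) ->
  (forall v, exists w, f w <> v) -> a <> b -> a <> c -> b <> c ->
  partially_shares f f1 a -> partially_shares f f1 b -> partially_shares f f1 c ->
  @continuous C_UniformSpace R_UniformSpace (density f f1 a b c) z.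
Proof.
  intros Hf Hnc Hab Hac Hbc Ha Hb Hcc.
  assert (Hc : cont f) by (apply ex_deriv_cont; intros w; exists (f1 w); apply Hf).
  assert (Hc1 : cont f1) by (apply ex_deriv_cont, (entire_deriv f f1 Hf)).
  destruct (classic (f z = a)) as [Ea|Na].
  { apply density_cont_at_value; auto. }
  destruct (classic (f z = b)) as [Eb|Nb].
  { apply (continuous_ext (density f f1 b a c)); [intros w; apply density_swap|].
    apply density_cont_at_value; auto. }
  destruct (classic (f z = c)) as [Ec|Nc].
  { apply (continuous_ext (density f f1 c a b)); [intros w; apply density_rot|].
    apply density_cont_at_value; auto. }
  apply (continuous_mult (fun w => Cmod (f1 w) * Cmod (f w - f1 w)%C)).
  - apply (continuous_mult (fun w => Cmod (f1 w))); apply ccont_Cmod; [apply Hc1|].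
    apply ccont_minus; [apply Hc|apply Hc1].
  - apply (continuous_mult (fun w => weight (Cmod (f w - a)%C) * weight (Cmod (f w - b)%C)));
      [|now apply weight_comp_cont].
    apply (continuous_mult (fun w => weight (Cmod (f w - a)%C))); now apply weight_comp_cont.
Qed.

(** The contribution chi''(v) |grad v|^2 of v = ln |f - a| to the Laplacian of ln S. *)
Definition laplacian_term (f f1 : C -> C) (a z : C) : R :=
  chi2 (ln (Cmod (f z - a)%C)) * Cmod (f1 z / (f z - a))%C ^ 2.

Lemma second_deriv_chi_ln_Cmod (f f1 f2 : C -> C) (a z e : C) :
  (forall w, cderiv f w (f1 w)) -> (forall w, cderiv f1 w (f2 w)) -> f z <> a ->
  second_deriv (fun t => chi (ln (Cmod (f (z + t * e) - a)%C)))
     (chi1 (ln (Cmod (f z - a)%C)) * Re (e * (f1 z / (f z - a)))%C)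
     (chi2 (ln (Cmod (f z - a)%C)) * Re (e * (f1 z / (f z - a)))%C ^ 2 +
      chi1 (ln (Cmod (f z - a)%C)) *
        Re (e * e * ((f2 z * (f z - a) - f1 z * f1 z) / ((f z - a) * (f z - a))))%C).
Proof.
  intros Hf Hf1 Hn.
  assert (Hg : forall w, cderiv (fun u => f u - a)%C w (f1 w)).
  { intros w. eapply cderiv_eq; [apply cderiv_minus; [apply Hf|apply cderiv_const]|ring]. }
  assert (T := second_deriv_ln_Cmod (fun u => f u - a)%C f1 z e (f2 z) Hg (Hf1 z) (Cminus_eq_contra _ _ Hn)).
  assert (Z : (z + 0 * e = z)%C) by ring.
  assert (U := second_deriv_comp chi chi1 _ _ _ _ chi_deriv (chi1_deriv _) T). cbv beta in U. rewrite Z in U.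
  eapply second_deriv_eq; [exact U|reflexivity|ring].
Qed.

Lemma Re_sum_dirs (k : C) : Re (1 * 1 * k)%C + Re (Ci * Ci * k)%C = 0.
Proof. destruct k as [x y]. simpl. ring. Qed.

Lemma Re_sq_sum_dirs (q : C) : Re (1 * q)%C ^ 2 + Re (Ci * q)%C ^ 2 = Cmod q ^ 2.
Proof. rewrite Cmod2_alt. destruct q as [x y]. simpl. ring. Qed.

(** Of the five summands of ln S the first two are harmonic.  For the other three, the part
    with chi' carries the Laplacian of ln |f - v| and cancels, and the part with chi'' carries
    Re(q)^2 + Re(i q)^2 = |q|^2 for q = f1 / (f - v). *)
Lemma density_laplacian (f f1 f2 f3 : C -> C) (a b c z : C) :
  (forall w, cderiv f w (f1 w)) -> (forall w, cderiv f1 w (f2 w)) -> (forall w, cderiv f2 w (f3 w)) ->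
  (forall w, @continuous C_UniformSpace R_UniformSpace (density f f1 a b c) w) ->
  0 < density f f1 a b c z ->
  exists d1 d2 e1 e2, second_deriv (fun t => ln (density f f1 a b c (z + t * 1)%C)) d1 d2 /\
    second_deriv (fun t => ln (density f f1 a b c (z + t * Ci)%C)) e1 e2 /\
    laplacian_term f f1 a z + laplacian_term f f1 b z + laplacian_term f f1 c z = d2 + e2.
Proof.
  intros Hf Hf1 Hf2 Hcont Hpos.
  assert (nz : forall w, 0 < density f f1 a b c w ->
    f1 w <> 0%R /\ (f w - f1 w)%C <> 0%R /\ f w <> a /\ f w <> b /\ f w <> c).
  { intros w Hw. unfold density in Hw. repeat split; intros E; revert Hw; rewrite E.
    - rewrite Cmod_0. lra.
    - rewrite Cmod_0. lra.
    - replace (a - a)%C with (RtoC 0) by ring. rewrite Cmod_0 weight_0. lra.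
    - replace (b - b)%C with (RtoC 0) by ring. rewrite Cmod_0 weight_0. lra.
    - replace (c - c)%C with (RtoC 0) by ring. rewrite Cmod_0 weight_0. lra. }
  assert (lnE : forall w, 0 < density f f1 a b c w -> ln (density f f1 a b c w) =
    ln (Cmod (f1 w)) + (ln (Cmod (f w - f1 w)%C) + (chi (ln (Cmod (f w - a)%C)) +
      (chi (ln (Cmod (f w - b)%C)) + chi (ln (Cmod (f w - c)%C)))))).
  { intros w Hw. destruct (nz w Hw) as [N1 [N2 [Na [Nb Nc]]]].
    assert (P1 := proj1 (Cmod_gt_0 _) N1). assert (P2 := proj1 (Cmod_gt_0 _) N2).
    assert (Pa := proj1 (Cmod_gt_0 _) (Cminus_eq_contra _ _ Na)).
    assert (Pb := proj1 (Cmod_gt_0 _) (Cminus_eq_contra _ _ Nb)).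
    assert (Pc := proj1 (Cmod_gt_0 _) (Cminus_eq_contra _ _ Nc)).
    unfold density. rewrite !weight_exp; try lra.
    rewrite !ln_mult; try (repeat apply Rmult_lt_0_compat; try apply exp_pos; assumption).
    rewrite !ln_exp. ring. }
  destruct (nz z Hpos) as [N1 [N2 [Na [Nb Nc]]]].
  assert (Hg : forall w, cderiv (fun u => f u - f1 u)%C w (f1 w - f2 w)%C)
    by (intros w; now apply cderiv_minus).
  assert (dir : forall e : C, exists d1,
    second_deriv (fun t => ln (density f f1 a b c (z + t * e)%C)) d1
     (Re (e * e * ((f3 z * f1 z - f2 z * f2 z) / (f1 z * f1 z)))%C +
     (Re (e * e * (((f2 z - f3 z) * (f z - f1 z) - (f1 z - f2 z) * (f1 z - f2 z)) /
         ((f z - f1 z) * (f z - f1 z))))%C +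
     ((chi2 (ln (Cmod (f z - a)%C)) * Re (e * (f1 z / (f z - a)))%C ^ 2 +
      chi1 (ln (Cmod (f z - a)%C)) *
        Re (e * e * ((f2 z * (f z - a) - f1 z * f1 z) / ((f z - a) * (f z - a))))%C) +
     ((chi2 (ln (Cmod (f z - b)%C)) * Re (e * (f1 z / (f z - b)))%C ^ 2 +
      chi1 (ln (Cmod (f z - b)%C)) *
        Re (e * e * ((f2 z * (f z - b) - f1 z * f1 z) / ((f z - b) * (f z - b))))%C) +
     (chi2 (ln (Cmod (f z - c)%C)) * Re (e * (f1 z / (f z - c)))%C ^ 2 +
      chi1 (ln (Cmod (f z - c)%C)) *
        Re (e * e * ((f2 z * (f z - c) - f1 z * f1 z) / ((f z - c) * (f z - c))))%C)))))).
  { intros e.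
    assert (T1 := second_deriv_ln_Cmod f1 f2 z e (f3 z) Hf1 (Hf2 z) N1).
    assert (T2 := second_deriv_ln_Cmod (fun u => f u - f1 u)%C (fun u => f1 u - f2 u)%C z e (f2 z - f3 z)%C
       Hg (cderiv_minus _ _ _ _ _ (Hf1 z) (Hf2 z)) N2).
    assert (Ta := second_deriv_chi_ln_Cmod f f1 f2 a z e Hf Hf1 Na).
    assert (Tb := second_deriv_chi_ln_Cmod f f1 f2 b z e Hf Hf1 Nb).
    assert (Tc := second_deriv_chi_ln_Cmod f f1 f2 c z e Hf Hf1 Nc).
    eexists. eapply second_deriv_ext_loc;
      [|exact (second_deriv_plus _ _ _ _ _ _ T1
        (second_deriv_plus _ _ _ _ _ _ T2 (second_deriv_plus _ _ _ _ _ _ Ta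
        (second_deriv_plus _ _ _ _ _ _ Tb Tc))))].
    assert (L : locally 0 (fun t : R => 0 < density f f1 a b c (z + t * e)%C)).
    { apply (continuous_pos_near (T := R_UniformSpace) (fun t : R => density f f1 a b c (z + t * e)%C)).
      - apply (@continuous_comp R_UniformSpace C_UniformSpace R_UniformSpace (fun t : R => z + t * e)%C);
          [apply Rcont_line|apply Hcont].
      - now replace (z + 0 * e)%C with z by ring. }
    revert L. apply filter_imp. intros t Ht. symmetry. exact (lnE _ Ht). }
  destruct (dir 1%C) as [d1 D1]. destruct (dir Ci) as [e1 D1'].
  exists d1. eexists. exists e1. eexists. split; [exact D1|]. split; [exact D1'|].
  unfold laplacian_term. rewrite -!Re_sq_sum_dirs.
  assert (S1 := Re_sum_dirs ((f3 z * f1 z - f2 z * f2 z) / (f1 z * f1 z))%C).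
  assert (S2 := Re_sum_dirs (((f2 z - f3 z) * (f z - f1 z) - (f1 z - f2 z) * (f1 z - f2 z)) /
         ((f z - f1 z) * (f z - f1 z)))%C).
  assert (Sa := Re_sum_dirs ((f2 z * (f z - a) - f1 z * f1 z) / ((f z - a) * (f z - a)))%C).
  assert (Sb := Re_sum_dirs ((f2 z * (f z - b) - f1 z * f1 z) / ((f z - b) * (f z - b)))%C).
  assert (Sc := Re_sum_dirs ((f2 z * (f z - c) - f1 z * f1 z) / ((f z - c) * (f z - c)))%C).
  apply Rplus_opp_r_uniq in S1, S2, Sa, Sb, Sc. rewrite S1 S2 Sa Sb Sc. ring.
Qed.

(** With s = |f1| and G the product of the weights, the density is at most
    s (|f| + s) G, and the choice y = s sqrt (K L) dominates it by y + y^2. *)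
Lemma density_zero (f f1 : C -> C) (a b c : C) : (forall w, cderiv f w (f1 w)) ->
  (forall v, exists w, f w <> v) -> a <> b -> a <> c -> b <> c ->
  partially_shares f f1 a -> partially_shares f f1 b -> partially_shares f f1 c ->
  forall z, density f f1 a b c z = 0.
Proof.
  intros Hf Hnc Hab Hac Hbc Ha Hb Hc.
  assert (He1 := entire_deriv f f1 Hf). assert (Hf1 := entire_cderiv f1 He1).
  set (f2 := C_derive f1) in *. assert (He2 := entire_deriv f1 f2 Hf1).
  assert (Hf2 := entire_cderiv f2 He2). set (f3 := C_derive f2) in *.
  assert (Hcont := fun z => density_cont f f1 a b c z Hf Hnc Hab Hac Hbc Ha Hb Hc).
  destruct (weights_bound_values a b c Hab Hac Hbc) as [K [HK W]].
  apply (ahlfors_vanishing _ (fun z => laplacian_term f f1 a z + laplacian_term f f1 b z + laplacian_term f f1 c z) K);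
    [apply density_ge0|exact Hcont|exact HK|].
  intros z Hz. split; [|exact (density_laplacian f f1 f2 f3 a b c z Hf Hf1 Hf2 Hcont Hz)].
  assert (nz : f z <> a /\ f z <> b /\ f z <> c).
  { unfold density in Hz. repeat split; intros E; revert Hz; rewrite E.
    - replace (a - a)%C with (RtoC 0) by ring. rewrite Cmod_0 weight_0. lra.
    - replace (b - b)%C with (RtoC 0) by ring. rewrite Cmod_0 weight_0. lra.
    - replace (c - c)%C with (RtoC 0) by ring. rewrite Cmod_0 weight_0. lra. }
  destruct nz as [Na [Nb Nc]].
  destruct (W (f z) Na Nb Nc) as [W1 W2].
  set (G := weight (Cmod (f z - a)%C) * weight (Cmod (f z - b)%C) * weight (Cmod (f z - c)%C)) in *.
  set (L := chi2 (ln (Cmod (f z - a)%C)) / Cmod (f z - a)%C ^ 2 +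
    chi2 (ln (Cmod (f z - b)%C)) / Cmod (f z - b)%C ^ 2 + chi2 (ln (Cmod (f z - c)%C)) / Cmod (f z - c)%C ^ 2) in *.
  set (s := Cmod (f1 z)). assert (Hs := Cmod_ge_0 (f1 z)). fold s in Hs.
  assert (G0 : 0 <= G) by (unfold G; repeat apply Rmult_le_pos; apply weight_ge0).
  assert (KL : 0 <= K * L) by lra.
  assert (XL : laplacian_term f f1 a z + laplacian_term f f1 b z + laplacian_term f f1 c z = s * s * L).
  { assert (term : forall v, f z <> v -> laplacian_term f f1 v z =
       s * s * (chi2 (ln (Cmod (f z - v)%C)) / Cmod (f z - v)%C ^ 2)).
    { intros v Hv. unfold laplacian_term. assert (N := Cminus_eq_contra _ _ Hv).
      assert (P := proj1 (Cmod_gt_0 _) N). rewrite Cmod_div //. fold s. field. lra. }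
    rewrite !term //. unfold L. ring. }
  exists (s * sqrt (K * L)). assert (q := sqrt_pos (K * L)). assert (q2 := sqrt_sqrt (K * L) KL).
  split; [now apply Rmult_le_pos|]. split.
  - rewrite XL. right. transitivity (s * s * (sqrt (K * L) * sqrt (K * L))); [ring|]. rewrite q2. ring.
  - unfold density. fold s G.
    assert (T := Cmod_triangle (f z) (- f1 z)%C). rewrite Cmod_opp in T. fold s in T.
    change (f z + - f1 z)%C with (f z - f1 z)%C in T.
    assert (WG : Cmod (f z) * G <= sqrt (K * L)).
    { apply Rsqr_incr_0; [|apply Rmult_le_pos; [apply Cmod_ge_0|exact G0]|exact q].
      unfold Rsqr. rewrite q2. replace (Cmod (f z) * G * (Cmod (f z) * G)) with ((Cmod (f z) * G) ^ 2) by ring.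
      exact W2. }
    apply Rle_trans with (s * (Cmod (f z) + s) * G).
    + apply Rmult_le_compat_r; [exact G0|]. now apply Rmult_le_compat_l.
    + replace (s * (Cmod (f z) + s) * G) with (s * (Cmod (f z) * G) + s * s * G) by ring.
      replace (s * sqrt (K * L) * (s * sqrt (K * L))) with (s * s * (sqrt (K * L) * sqrt (K * L))) by ring.
      rewrite q2. apply Rplus_le_compat; [now apply Rmult_le_compat_l|].
      apply Rmult_le_compat_l; [nra|exact W1].
Qed.

Theorem theorem1p3 (f : C -> C) (a1 a2 a3 : C)
  (f_entire : entire f) (f_nonconstant : nonconstant f)
  (a12 : a1 <> a2) (a13 : a1 <> a3) (a23 : a2 <> a3)
  (share1 : partially_shares f (C_derive f) a1)
  (share2 : partially_shares f (C_derive f) a2)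
  (share3 : partially_shares f (C_derive f) a3) :
  forall z : C, f z = C_derive f z.
Proof.
  assert (Hf := entire_cderiv f f_entire). set (f1 := C_derive f) in *.
  assert (Hnc : forall v, exists w, f w <> v).
  { intros v. apply NNPP. intros H. apply f_nonconstant. exists v. intros z.
    apply NNPP. intros Hz. apply H. now exists z. }
  assert (He1 := entire_deriv f f1 Hf).
  assert (dich : forall z, f1 z = 0%R \/ f z = f1 z).
  { intros z. assert (D := density_zero f f1 a1 a2 a3 Hf Hnc a12 a13 a23 share1 share2 share3 z).
    destruct (classic (f z = a1)) as [E1|N1]; [right; rewrite (share1 z E1); exact E1|].
    destruct (classic (f z = a2)) as [E2|N2]; [right; rewrite (share2 z E2); exact E2|].
    destruct (classic (f z = a3)) as [E3|N3]; [right; rewrite (share3 z E3); exact E3|].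
    assert (pw : forall v, f z <> v -> weight (Cmod (f z - v)%C) <> 0).
    { intros v Hv. rewrite weight_exp.
      - apply Rgt_not_eq, exp_pos.
      - apply Rgt_not_eq, Cmod_gt_0. now apply Cminus_eq_contra. }
    unfold density in D. apply Rmult_integral in D. destruct D as [D|D].
    - apply Rmult_integral in D. destruct D as [D|D]; apply Cmod_eq_0 in D; [now left|right].
      now apply Ceq_minus.
    - exfalso. apply Rmult_integral in D. destruct D as [D|D]; [|now apply (pw a3 N3)].
      apply Rmult_integral in D. destruct D as [D|D]; [now apply (pw a1 N1)|now apply (pw a2 N2)]. }
  intros z. apply NNPP. intros Hz.
  assert (Hcg : cont (fun w => f w - f1 w)%C).
  { intros w. apply ccont_minus; [now apply ex_deriv_cont|now apply ex_deriv_cont]. }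
  destruct (cont_away_from_zero (fun w => f w - f1 w)%C z Hcg (Cminus_eq_contra _ _ Hz)) as [d [Hd B]].
  assert (P := proj1 (Cmod_gt_0 _) (Cminus_eq_contra _ _ Hz)).
  assert (Z : forall w, f1 w = 0%R).
  { apply (entire_zero_near f1 z d He1 Hd). intros w Hw. destruct (dich w) as [E|E]; [exact E|exfalso].
    specialize (B w Hw). simpl in B. rewrite E in B.
    replace (f1 w - f1 w)%C with (RtoC 0) in B by ring. rewrite Cmod_0 in B. lra. }
  apply f_nonconstant. exists (f 0%R). apply deriv_zero_const. intros w. rewrite -(Z w). apply Hf.
Qed.
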